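(* Let $m,s,r,l,t$ be integers satisfying $s,r,l,t\ge 0$; $m-s-r,\ m-s-l,\ m-r-t,\ m-l-t\ge 0$; and $s+r+l+t-m\ge 0$. Set $n=s+r+l+t-m$. Then on $\mathcal{O}(U_q(3))$ the Haar state $\mathbf h$ satisfies $$\mathbf h\left(c^me^mg^m\cdot\mathrm{det}_q^{-m}\right)=\frac{(-q)^{3m}(q^2-1)^2(q^4-1)}{(q^{2m+2}-1)^2(q^{2m+4}-1)},$$ and $$\mathbf h\left(a^sb^{m-s-r}c^rd^{m-s-l}e^{n}f^{m-r-t}g^lh^{m-l-t}k^t\cdot\mathrm{det}_q^{-m}\right)$$ $$=\left(\sum_{j=0}^{n}(-1)^{j}q^{(n-j)(n-3j-1)+2j(s+t)}\frac{\binom{r}{j}_{q^2}\binom{l}{j}_{q^2}\binom{s}{n-j}_{q^2}\binom{t}{n-j}_{q^2}}{\binom{n}{j}_{q^2}}\right)$$ $$\times\frac{(-1)^{r+l+n}\,q^{(2m+1)(l+r)+(n-2)m-2l^2-2r^2-rl+4st-3ns-3nt}}{\binom{m}{n,\;m-l-s,\;m-r-t}_{q^2}\binom{m}{n,\;m-r-s,\;m-l-t}_{q^2}}\cdot \mathbf h\left(c^me^mg^m\cdot\mathrm{det}_q^{-m}\right).$$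
   Context: Let $q$ be real, $q\notin\{0,1,-1\}$. $\mathcal{O}(Mat_q(3))$ is the unital associative $\mathbb{C}$-algebra generated by $x_{i,j}$, $1\le i,j\le 3$, with relations, for $i<l$ and $j<k$: $x_{i,j}x_{l,j}=q\,x_{l,j}x_{i,j}$, $x_{i,j}x_{i,k}=q\,x_{i,k}x_{i,j}$, $x_{i,k}x_{l,j}=x_{l,j}x_{i,k}$, $x_{i,j}x_{l,k}=x_{l,k}x_{i,j}+(q-q^{-1})x_{i,k}x_{l,j}$. It is a bialgebra with algebra homomorphisms $\Delta(x_{i,j})=\sum_{p}x_{i,p}\otimes x_{p,j}$, $\varepsilon(x_{i,j})=\delta_{i,j}$. The quantum determinant $D_q=\sum_{\sigma\in\mathfrak S_3}(-q)^{\ell(\sigma)}x_{1,\sigma(1)}x_{2,\sigma(2)}x_{3,\sigma(3)}$ ($\ell$ = number of inversions) is central. $\mathcal{O}(GL_q(3))$ is obtained by adjoining a central inverse $\mathrm{det}_q^{-1}$ of $D_q$, with $\Delta(\mathrm{det}_q^{-1})=\mathrm{det}_q^{-1}\otimes\mathrm{det}_q^{-1}$, $\varepsilon(\mathrm{det}_q^{-1})=1$; it is a Hopf algebra, and $\mathcal{O}(U_q(3))$ is this Hopf algebra with a compatible $*$-structure (not needed for the statement). The Haar state $\mathbf h$ is the unique linear functional with $\mathbf h(1)=1$ and $(\mathrm{id}\otimes \mathbf h)\Delta(x)=\mathbf h(x)1=(\mathbf h\otimes\mathrm{id})\Delta(x)$ for all $x$. (The Haar state is written in boldface to distinguish it from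 the generator $h$.) The generators are renamed as $$\begin{bmatrix} x_{1,1} & x_{1,2} & x_{1,3} \\ x_{2,1} & x_{2,2} & x_{2,3} \\ x_{3,1} & x_{3,2} & x_{3,3} \end{bmatrix}=\begin{bmatrix} a & b & c \\ d & e & f \\ g & h & k \end{bmatrix}.$$ Notation: $(x;p)_N=\prod_{i=0}^{N-1}(1-xp^i)$, $(x;p)_0=1$; $\binom{N}{j}_{q^2}=\frac{(q^2;q^2)_N}{(q^2;q^2)_j(q^2;q^2)_{N-j}}$ for $0\le j\le N$ and $0$ for other integers $j$; for $N=N_1+N_2+N_3$ with $N_i\ge0$, $\binom{N}{N_1,N_2,N_3}_{q^2}=\frac{(q^2;q^2)_N}{(q^2;q^2)_{N_1}(q^2;q^2)_{N_2}(q^2;q^2)_{N_3}}$. *)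

(* Defs.v *)
From HB Require Import structures.
From mathcomp Require Import all_boot all_order all_algebra perm.
From mathcomp Require Import boolp reals.
From mathcomp Require Import complex ring.

Set Implicit Arguments.
Unset Strict Implicit.
Unset Printing Implicit Defensive.

Import GRing.Theory.
Local Open Scope ring_scope.
Local Open Scope quotient_scope.

Inductive ncterm (K X : Type) : Type :=
  | Cst of K
  | Gen of X
  | Add of ncterm K X & ncterm K X
  | Mul of ncterm K X & ncterm K X.
Arguments Cst {K X}.
Arguments Gen {K X}.

HB.instance Definition _ (K X : Type) := gen_eqMixin (ncterm K X).
HB.instance Definition _ (K X : Type) := gen_choiceMixin (ncterm K X).

Fixpoint nceval (K : fieldType) (X : Type) (B : algType K) (f : X -> B)
    (t : ncterm K X) : B :=
  match t with
  | Cst c => c%:A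
  | Gen x => f x
  | Add t u => nceval f t + nceval f u
  | Mul t u => nceval f t * nceval f u
  end.

(* The least congruence which contains [rel] and whose quotient is a unital
   associative [K]-algebra. *)
Inductive nccong (K : fieldType) (X : Type)
    (rel : ncterm K X -> ncterm K X -> Prop) :
    ncterm K X -> ncterm K X -> Prop :=
  | nc_rel t u : rel t u -> nccong rel t u
  | nc_refl t : nccong rel t t
  | nc_sym t u : nccong rel t u -> nccong rel u t
  | nc_trans u t v : nccong rel t u -> nccong rel u v -> nccong rel t v
  | nc_add t t' u u' :
      nccong rel t t' -> nccong rel u u' -> nccong rel (Add t u) (Add t' u')
  | nc_mul t t' u u' :
      nccong rel t t' -> nccong rel u u' -> nccong rel (Mul t u) (Mul t' u')
  | nc_addA t u v : nccong rel (Add t (Add u v)) (Add (Add t u) v)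
  | nc_addC t u : nccong rel (Add t u) (Add u t)
  | nc_add0 t : nccong rel (Add (Cst 0) t) t
  | nc_mulA t u v : nccong rel (Mul t (Mul u v)) (Mul (Mul t u) v)
  | nc_mul1 t : nccong rel (Mul (Cst 1) t) t
  | nc_mul0 t : nccong rel (Mul (Cst 0) t) (Cst 0)
  | nc_mulDl t u v :
      nccong rel (Mul (Add t u) v) (Add (Mul t v) (Mul u v))
  | nc_mulDr t u v :
      nccong rel (Mul t (Add u v)) (Add (Mul t u) (Mul t v))
  | nc_cstD c d : nccong rel (Cst (c + d)) (Add (Cst c) (Cst d))
  | nc_cstM c d : nccong rel (Cst (c * d)) (Mul (Cst c) (Cst d))
  | nc_cstC c t : nccong rel (Mul (Cst c) t) (Mul t (Cst c)).

Lemma nceval_cong (K : fieldType) (X : Type)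
    (rel : ncterm K X -> ncterm K X -> Prop) (B : algType K) (f : X -> B) :
  (forall t u, rel t u -> nceval f t = nceval f u) ->
  forall t u, nccong rel t u -> nceval f t = nceval f u.
Proof.
move=> frel t u; elim=> //=.
- by move=> > _ -> _ ->.
- by move=> > _ -> _ ->.
- by move=> > _ -> _ ->.
- by move=> *; rewrite addrA.
- by move=> *; rewrite addrC.
- by move=> *; rewrite scale0r add0r.
- by move=> *; rewrite mulrA.
- by move=> *; rewrite scale1r mul1r.
- by move=> *; rewrite scale0r mul0r.
- by move=> *; rewrite mulrDl.
- by move=> *; rewrite mulrDr.
- by move=> *; rewrite scalerDl.
- by move=> *; rewrite -scalerAl mul1r scalerA.
- by move=> *; rewrite -scalerAl -scalerAr mul1r mulr1.
Qed.

Section Presented.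
Variables (K : fieldType) (X : Type) (rel : ncterm K X -> ncterm K X -> Prop).
Local Notation term := (ncterm K X).
Local Notation "t ~ u" := (nccong rel t u) (at level 70).

Definition nccongb (t u : term) : bool := `[< t ~ u >].

Lemma nccongb_equiv : equiv_class_of nccongb.
Proof.
split.
- by move=> t; apply/asboolP/nc_refl.
- by move=> t u; apply/asbool_equiv_eq; split; apply: nc_sym.
- move=> u t v /asboolP tu /asboolP uv; apply/asboolP.
  exact: nc_trans tu uv.
Qed.

Canonical nccong_equivRel := EquivRelPack nccongb_equiv.

Definition presented := {eq_quot nccong_equivRel}.
HB.instance Definition _ := Choice.on presented.

Definition pcls (t : term) : presented := \pi_presented t.

Lemma pclsP t u : pcls t = pcls u <-> t ~ u.
Proof.
by split=> [/eqmodP/asboolP //|tu]; apply/eqmodP/asboolP.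
Qed.

Lemma pclsK (x : presented) : pcls (repr x) = x.
Proof. exact: reprK. Qed.

Lemma repr_pcls t : repr (pcls t) ~ t.
Proof. by apply/pclsP; rewrite pclsK. Qed.

Let padd (x y : presented) := pcls (Add (repr x) (repr y)).
Let pmul (x y : presented) := pcls (Mul (repr x) (repr y)).
Let popp (x : presented) := pcls (Mul (Cst (- 1)) (repr x)).
Let pscale (c : K) (x : presented) := pcls (Mul (Cst c) (repr x)).

Let paddE t u : padd (pcls t) (pcls u) = pcls (Add t u).
Proof. by apply/pclsP/nc_add; apply: repr_pcls. Qed.
Let pmulE t u : pmul (pcls t) (pcls u) = pcls (Mul t u).
Proof. by apply/pclsP/nc_mul; apply: repr_pcls. Qed.
Let poppE t : popp (pcls t) = pcls (Mul (Cst (- 1)) t).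
Proof. by apply/pclsP/nc_mul; [apply: nc_refl | apply: repr_pcls]. Qed.
Let pscaleE c t : pscale c (pcls t) = pcls (Mul (Cst c) t).
Proof. by apply/pclsP/nc_mul; [apply: nc_refl | apply: repr_pcls]. Qed.

Let pind (P : presented -> Prop) : (forall t, P (pcls t)) -> forall x, P x.
Proof. by move=> Pt x; rewrite -(pclsK x). Qed.

Let paddA : associative padd.
Proof.
elim/pind=> t; elim/pind=> u; elim/pind=> v.
by rewrite !paddE; apply/pclsP/nc_addA.
Qed.
Let paddC : commutative padd.
Proof.
by elim/pind=> t; elim/pind=> u; rewrite !paddE; apply/pclsP/nc_addC.
Qed.
Let padd0 : left_id (pcls (Cst 0)) padd.
Proof. by elim/pind=> t; rewrite paddE; apply/pclsP/nc_add0. Qed.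
Let paddN : left_inverse (pcls (Cst 0)) popp padd.
Proof.
elim/pind=> t; rewrite poppE paddE; apply/pclsP.
apply: nc_trans (nc_mul0 rel t).
have -> : 0 = - 1 + 1 :> K by rewrite addNr.
apply: (nc_trans (u := Mul (Add (Cst (- 1)) (Cst 1)) t)).
  apply: nc_trans (nc_sym (nc_mulDl _ _ _ _)).
  by apply: nc_add; [apply: nc_refl | apply/nc_sym/nc_mul1].
by apply: nc_mul; [apply/nc_sym/nc_cstD | apply: nc_refl].
Qed.
HB.instance Definition _ :=
  GRing.isZmodule.Build presented paddA paddC padd0 paddN.

Let pmulA : associative pmul.
Proof.
elim/pind=> t; elim/pind=> u; elim/pind=> v.
by rewrite !pmulE; apply/pclsP/nc_mulA.
Qed.
Let pmul1 : left_id (pcls (Cst 1)) pmul.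
Proof. by elim/pind=> t; rewrite pmulE; apply/pclsP/nc_mul1. Qed.
Let pmulr1 : right_id (pcls (Cst 1)) pmul.
Proof.
elim/pind=> t; rewrite pmulE; apply/pclsP.
exact: nc_trans (nc_sym (nc_cstC _ _ _)) (nc_mul1 _ _).
Qed.
Let pmulDl : left_distributive pmul +%R.
Proof.
elim/pind=> t; elim/pind=> u; elim/pind=> v; rewrite /GRing.add /=.
by rewrite paddE !pmulE paddE; apply/pclsP/nc_mulDl.
Qed.
Let pmulDr : right_distributive pmul +%R.
Proof.
elim/pind=> t; elim/pind=> u; elim/pind=> v; rewrite /GRing.add /=.
by rewrite paddE !pmulE paddE; apply/pclsP/nc_mulDr.
Qed.
HB.instance Definition _ :=
  GRing.Zmodule_isPzRing.Build presented pmulA pmul1 pmulr1 pmulDl pmulDr.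

Let pscaleA a b v : pscale a (pscale b v) = pscale (a * b) v.
Proof.
elim/pind: v => t; rewrite !pscaleE; apply/pclsP.
apply: nc_trans (nc_mulA _ _ _ _) _.
by apply: nc_mul; [apply/nc_sym/nc_cstM | apply: nc_refl].
Qed.
Let pscale1 : left_id 1 pscale.
Proof. by elim/pind=> t; rewrite pscaleE; apply/pclsP/nc_mul1. Qed.
Let pscaleDr : right_distributive pscale +%R.
Proof.
move=> c; elim/pind=> t; elim/pind=> u; rewrite /GRing.add /=.
by rewrite paddE !pscaleE paddE; apply/pclsP/nc_mulDr.
Qed.
Let pscaleDl v : {morph pscale^~ v : a b / a + b}.
Proof.
move=> a b; elim/pind: v => t; rewrite /GRing.add /= !pscaleE paddE.
apply/pclsP; apply: nc_trans (nc_mulDl _ _ _ _).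
by apply: nc_mul; [apply/nc_cstD | apply: nc_refl].
Qed.
HB.instance Definition _ :=
  GRing.Zmodule_isLmodule.Build K presented pscaleA pscale1 pscaleDr pscaleDl.

Lemma pclsD t u : pcls (Add t u) = pcls t + pcls u.
Proof. by rewrite /GRing.add /= paddE. Qed.
Lemma pclsM t u : pcls (Mul t u) = pcls t * pcls u.
Proof. by rewrite /GRing.mul /= pmulE. Qed.
Lemma pclsZ c t : pcls (Mul (Cst c) t) = c *: pcls t.
Proof. by rewrite /GRing.scale /= pscaleE. Qed.
Lemma pcls0 : pcls (Cst 0) = 0. Proof. by []. Qed.
Lemma pcls1 : pcls (Cst 1) = 1. Proof. by []. Qed.
Lemma pclsC c : pcls (Cst c) = c *: (1 : presented).
Proof. by rewrite -pcls1 -pclsZ -[in LHS](mulr1 c); apply/pclsP/nc_cstM. Qed.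

Lemma presented_scalerAl c (x y : presented) : c *: (x * y) = c *: x * y.
Proof.
elim/pind: x => t; elim/pind: y => u.
by rewrite -pclsM -!pclsZ -pclsM; apply/pclsP/nc_mulA.
Qed.
Lemma presented_scalerAr c (x y : presented) : c *: (x * y) = x * (c *: y).
Proof.
elim/pind: x => t; elim/pind: y => u.
rewrite -pclsM -!pclsZ -pclsM; apply/pclsP.
apply: nc_trans (nc_mulA _ _ _ _) _.
apply: nc_trans (nc_sym (nc_mulA _ _ _ _)).
by apply: nc_mul; [apply/nc_cstC | apply: nc_refl].
Qed.
End Presented.

Definition is_bilinear (K : fieldType) (A U : lmodType K) (f : A -> A -> U) :=
  (forall a, linear (f a)) /\ (forall b, linear (f^~ b)).

Section BilinearTheory.
Variables (K : fieldType) (A U : lmodType K) (f : A -> A -> U).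
Hypothesis fbil : is_bilinear f.

Lemma bilDl a a' b : f (a + a') b = f a b + f a' b.
Proof. by have /(_ 1 a a') := fbil.2 b; rewrite !scale1r. Qed.
Lemma bilDr a b b' : f a (b + b') = f a b + f a b'.
Proof. by have /(_ 1 b b') := fbil.1 a; rewrite !scale1r. Qed.
Lemma bil0l b : f 0 b = 0.
Proof. by apply: (@addrI _ (f 0 b)); rewrite -bilDl !addr0. Qed.
Lemma bil0r a : f a 0 = 0.
Proof. by apply: (@addrI _ (f a 0)); rewrite -bilDr !addr0. Qed.
Lemma bilZl c a b : f (c *: a) b = c *: f a b.
Proof. by have /(_ c a 0) := fbil.2 b; rewrite bil0l !addr0. Qed.
Lemma bilZr c a b : f a (c *: b) = c *: f a b.
Proof. by have /(_ c b 0) := fbil.1 a; rewrite bil0r !addr0. Qed.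
End BilinearTheory.

Section TensorSquare.
Variables (K : fieldType) (A : algType K).

Definition formal_sum := seq (A * A).
HB.instance Definition _ := Choice.on formal_sum.

Definition fsum (U : lmodType K) (f : A -> A -> U) (s : formal_sum) : U :=
  \sum_(p <- s) f p.1 p.2.

(* Two formal sums of pure tensors are the same element of [A (x) A] when no
   bilinear map separates them. *)
Definition tsq_eqv (s t : formal_sum) : Prop :=
  forall (U : lmodType K) (f : A -> A -> U),
    is_bilinear f -> fsum f s = fsum f t.

Definition tsq_eqvb (s t : formal_sum) : bool := `[< tsq_eqv s t >].

Lemma tsq_eqvb_equiv : equiv_class_of tsq_eqvb.
Proof.
split.
- by move=> s; apply/asboolP.
- by move=> s t; apply/asbool_equiv_eq; split=> st U f fb; rewrite st.
- move=> t s u /asboolP st /asboolP tu; apply/asboolP => U f fb.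
  by rewrite st ?tu.
Qed.

Canonical tsq_equivRel := EquivRelPack tsq_eqvb_equiv.

Definition tsq := {eq_quot tsq_equivRel}.
HB.instance Definition _ := Choice.on tsq.

Definition tcls (s : formal_sum) : tsq := \pi_tsq s.
Definition tens (a b : A) : tsq := tcls [:: (a, b)].

Definition tlift (U : lmodType K) (f : A -> A -> U) (x : tsq) : U :=
  fsum f (repr x).

Lemma tclsP s t : tcls s = tcls t <-> tsq_eqv s t.
Proof. by split=> [/eqmodP/asboolP //|st]; apply/eqmodP/asboolP. Qed.

Lemma tclsK (x : tsq) : tcls (repr x) = x.
Proof. exact: reprK. Qed.

Lemma tliftE (U : lmodType K) (f : A -> A -> U) s :
  is_bilinear f -> tlift f (tcls s) = fsum f s.
Proof. by move=> fb; apply: (proj1 (tclsP _ _) _ U f fb); apply: tclsK. Qed.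

Lemma fsum_cat (U : lmodType K) (f : A -> A -> U) s t :
  fsum f (s ++ t) = fsum f s + fsum f t.
Proof. exact: big_cat. Qed.

Definition tscale_fs (c : K) (s : formal_sum) : formal_sum :=
  [seq (c *: p.1, p.2) | p <- s].
Definition tmul_fs (s t : formal_sum) : formal_sum :=
  [seq (p.1 * r.1, p.2 * r.2) | p <- s, r <- t].

Lemma fsum_scale (U : lmodType K) (f : A -> A -> U) c s :
  is_bilinear f -> fsum f (tscale_fs c s) = c *: fsum f s.
Proof.
by move=> fb; rewrite /fsum big_map scaler_sumr; apply: eq_bigr => p _;
   rewrite (bilZl fb).
Qed.

Lemma fsum_mul (U : lmodType K) (f : A -> A -> U) s t :
  fsum f (tmul_fs s t) =
  fsum (fun a b => fsum (fun a' b' => f (a * a') (b * b')) t) s.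
Proof. by rewrite /fsum big_allpairs_dep. Qed.

Lemma fsum_exch (U : lmodType K) (g : A -> A -> A -> A -> U) s t :
  fsum (fun a b => fsum (g a b) t) s =
  fsum (fun a' b' => fsum (fun a b => g a b a' b') s) t.
Proof. exact: exchange_big. Qed.

Lemma bil_mull (U : lmodType K) (f : A -> A -> U) a b :
  is_bilinear f -> is_bilinear (fun a' b' => f (a * a') (b * b')).
Proof.
move=> fb; split=> [a'|b'] c u v /=; rewrite mulrDr -scalerAr.
  by rewrite (bilDr fb) (bilZr fb).
by rewrite (bilDl fb) (bilZl fb).
Qed.

Lemma bil_mulr (U : lmodType K) (f : A -> A -> U) a' b' :
  is_bilinear f -> is_bilinear (fun a b => f (a * a') (b * b')).
Proof.
move=> fb; split=> [a|b] c u v /=; rewrite mulrDl -scalerAl.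
  by rewrite (bilDr fb) (bilZr fb).
by rewrite (bilDl fb) (bilZl fb).
Qed.

Let tadd (x y : tsq) := tcls (repr x ++ repr y).
Let tscale (c : K) (x : tsq) := tcls (tscale_fs c (repr x)).
Let tmul (x y : tsq) := tcls (tmul_fs (repr x) (repr y)).

Let repr_eqv s : tsq_eqv (repr (tcls s)) s.
Proof. by apply/tclsP; rewrite tclsK. Qed.

Let taddE s t : tadd (tcls s) (tcls t) = tcls (s ++ t).
Proof. by apply/tclsP => U f fb; rewrite !fsum_cat !(repr_eqv _ fb). Qed.

Let tscaleE c s : tscale c (tcls s) = tcls (tscale_fs c s).
Proof. by apply/tclsP => U f fb; rewrite !fsum_scale // (repr_eqv _ fb). Qed.

Let tmulE s t : tmul (tcls s) (tcls t) = tcls (tmul_fs s t).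
Proof.
apply/tclsP => U f fb; rewrite !fsum_mul.
transitivity (fsum (fun a b => fsum (fun a' b' => f (a * a') (b * b')) t)
                   (repr (tcls s))).
  by apply: eq_bigr => p _; apply/repr_eqv/bil_mull.
rewrite !(fsum_exch (fun a b a' b' => f (a * a') (b * b'))).
by apply: eq_bigr => p _; apply/repr_eqv/bil_mulr.
Qed.

Let tind (P : tsq -> Prop) : (forall s, P (tcls s)) -> forall x, P x.
Proof. by move=> Ps x; rewrite -(tclsK x). Qed.

Let taddA : associative tadd.
Proof.
by elim/tind=> s; elim/tind=> t; elim/tind=> u; rewrite !taddE catA.
Qed.
Let taddC : commutative tadd.
Proof.
elim/tind=> s; elim/tind=> t; rewrite !taddE.
by apply/tclsP => U f fb; rewrite !fsum_cat addrC.
Qed.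
Let tadd0 : left_id (tcls [::]) tadd.
Proof. by elim/tind=> s; rewrite taddE. Qed.
Let taddN : left_inverse (tcls [::]) (tscale (- 1)) tadd.
Proof.
elim/tind=> s; rewrite tscaleE taddE; apply/tclsP => U f fb.
by rewrite fsum_cat fsum_scale // scaleN1r addNr /fsum big_nil.
Qed.
HB.instance Definition _ :=
  GRing.isZmodule.Build tsq taddA taddC tadd0 taddN.

Let tscaleA a b v : tscale a (tscale b v) = tscale (a * b) v.
Proof.
elim/tind: v => s; rewrite !tscaleE; apply/tclsP => U f fb.
by rewrite !fsum_scale // scalerA.
Qed.
Let tscale1 : left_id 1 tscale.
Proof.
elim/tind=> s; rewrite tscaleE; apply/tclsP => U f fb.
by rewrite fsum_scale // scale1r.
Qed.
Let tscaleDr : right_distributive tscale +%R.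
Proof.
move=> c; elim/tind=> s; elim/tind=> t; rewrite /GRing.add /=.
rewrite taddE !tscaleE taddE; apply/tclsP => U f fb.
by rewrite fsum_cat !fsum_scale // fsum_cat scalerDr.
Qed.
Let tscaleDl v : {morph tscale^~ v : a b / a + b}.
Proof.
move=> a b; elim/tind: v => s; rewrite /GRing.add /= !tscaleE taddE.
by apply/tclsP => U f fb; rewrite fsum_cat !fsum_scale // scalerDl.
Qed.
HB.instance Definition _ :=
  GRing.Zmodule_isLmodule.Build K tsq tscaleA tscale1 tscaleDr tscaleDl.

Let tmulA : associative tmul.
Proof.
elim/tind=> s; elim/tind=> t; elim/tind=> u; rewrite !tmulE.
apply/tclsP => U f fb; rewrite !fsum_mul; apply: eq_bigr => p _.
rewrite fsum_mul; apply: eq_bigr => r _; apply: eq_bigr => v _ /=.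
by rewrite !mulrA.
Qed.
Let tmul1 : left_id (tens 1 1) tmul.
Proof.
elim/tind=> s; rewrite tmulE; congr tcls; rewrite /tmul_fs /= cats0.
by rewrite -[RHS]map_id; apply: eq_map => -[a b] /=; rewrite !mul1r.
Qed.
Let tmulr1 : right_id (tens 1 1) tmul.
Proof.
elim/tind=> s; rewrite tmulE; apply/tclsP => U f fb.
rewrite fsum_mul; apply: eq_bigr => p _.
by rewrite /fsum big_seq1 !mulr1.
Qed.
Let tmulDl : left_distributive tmul +%R.
Proof.
elim/tind=> s; elim/tind=> t; elim/tind=> u; rewrite /GRing.add /=.
rewrite taddE !tmulE taddE; apply/tclsP => U f fb.
by rewrite fsum_cat !fsum_mul fsum_cat.
Qed.
Let tmulDr : right_distributive tmul +%R.
Proof.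
elim/tind=> s; elim/tind=> t; elim/tind=> u; rewrite /GRing.add /=.
rewrite taddE !tmulE taddE; apply/tclsP => U f fb.
rewrite fsum_cat !fsum_mul -big_split; apply: eq_bigr => p _.
by rewrite fsum_cat.
Qed.

(* The multiplication of [A] separates [1 (x) 1] from [0]. *)
Let tone_neq0 : tens 1 1 != 0.
Proof.
apply/eqP => /tclsP /(_ A *%R) t10.
have mulbil : is_bilinear ( *%R : A -> A -> A).
  split=> [a|b] c u v; first by rewrite mulrDr scalerAr.
  by rewrite mulrDl scalerAl.
move: (t10 mulbil); rewrite /fsum big_nil big_seq1 mulr1.
exact/eqP/oner_neq0.
Qed.
HB.instance Definition _ :=
  GRing.Zmodule_isNzRing.Build tsq tmulA tmul1 tmulr1 tmulDl tmulDr tone_neq0.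

Let tscalerAl c (x y : tsq) : c *: (x * y) = c *: x * y.
Proof.
elim/tind: x => s; elim/tind: y => t; rewrite /GRing.scale /GRing.mul /=.
rewrite tmulE !tscaleE tmulE; apply/tclsP => U f fb.
rewrite fsum_scale // !fsum_mul {3}/fsum big_map scaler_sumr.
apply: eq_bigr => p _; rewrite scaler_sumr; apply: eq_bigr => r _ /=.
by rewrite -scalerAl (bilZl fb).
Qed.
HB.instance Definition _ := GRing.Lmodule_isLalgebra.Build K tsq tscalerAl.

Let tscalerAr c (x y : tsq) : c *: (x * y) = x * (c *: y).
Proof.
elim/tind: x => s; elim/tind: y => t; rewrite /GRing.scale /GRing.mul /=.
rewrite tmulE !tscaleE tmulE; apply/tclsP => U f fb.
rewrite fsum_scale // !fsum_mul scaler_sumr.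
apply: eq_bigr => p _; rewrite /fsum big_map scaler_sumr.
by apply: eq_bigr => r _ /=; rewrite -scalerAr (bilZl fb).
Qed.
HB.instance Definition _ := GRing.Lalgebra_isAlgebra.Build K tsq tscalerAr.

Lemma tclsD s t : tcls (s ++ t) = tcls s + tcls t.
Proof. by rewrite /GRing.add /= taddE. Qed.

Lemma tclsZ c s : tcls (tscale_fs c s) = c *: tcls s.
Proof. by rewrite /GRing.scale /= tscaleE. Qed.

Lemma tens_bilinear : is_bilinear tens.
Proof.
split=> [a|b] c u v; rewrite -tclsZ -tclsD;
  apply/tclsP => U f fb; rewrite fsum_cat fsum_scale // /fsum !big_seq1 /=.
- by rewrite (bilDr fb) (bilZr fb).
- by rewrite (bilDl fb) (bilZl fb).
Qed.

Lemma tensM a b a' b' : tens a b * tens a' b' = tens (a * a') (b * b').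
Proof. by rewrite /GRing.mul /= tmulE. Qed.

Lemma tens1 : tens 1 1 = 1. Proof. by []. Qed.

Lemma tclsE s : tcls s = \sum_(p <- s) tens p.1 p.2.
Proof.
elim: s => [|[a b] s IHs]; first by rewrite big_nil.
by rewrite big_cons -IHs -tclsD.
Qed.

Lemma tlift_linear (U : lmodType K) (f : A -> A -> U) :
  is_bilinear f -> linear (tlift f).
Proof.
move=> fb c; elim/tind=> s; elim/tind=> t.
by rewrite -tclsZ -tclsD !tliftE // fsum_cat fsum_scale.
Qed.

Lemma tlift_tens (U : lmodType K) (f : A -> A -> U) a b :
  is_bilinear f -> tlift f (tens a b) = f a b.
Proof. by move=> fb; rewrite tliftE // /fsum big_seq1. Qed.

End TensorSquare.

Definition i1 : 'I_3 := @Ordinal 3 0 isT.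
Definition i2 : 'I_3 := @Ordinal 3 1 isT.
Definition i3 : 'I_3 := @Ordinal 3 2 isT.

Definition inversions (n : nat) (s : 'S_n) : nat :=
  #|[set p : 'I_n * 'I_n | (p.1 < p.2)%N && (s p.2 < s p.1)%N]|.

Definition qdet (K : fieldType) (B : algType K) (q : K)
    (x : 'I_3 -> 'I_3 -> B) : B :=
  \sum_(s : 'S_3)
    (- q) ^+ inversions s *: (x i1 (s i1) * x i2 (s i2) * x i3 (s i3)).

Lemma big_I3 (T : Type) (idx : T) (op : Monoid.law idx) (F : 'I_3 -> T) :
  \big[op/idx]_i F i = op (F i1) (op (F i2) (F i3)).
Proof.
rewrite !big_ord_recl big_ord0 Monoid.mulm1.
by congr (op (F _) (op (F _) (F _))); apply: val_inj.
Qed.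

Lemma I3P (P : 'I_3 -> Prop) : P i1 -> P i2 -> P i3 -> forall i, P i.
Proof.
move=> P1 P2 P3 [[|[|[|//]]] lti]; [move: P1|move: P2|move: P3];
  by congr P; apply: val_inj.
Qed.

Lemma inversions3 (s : 'S_3) :
  inversions s =
  ((s i2 < s i1) + ((s i3 < s i1) + (s i3 < s i2)))%N.
Proof.
rewrite /inversions cardsE -sum1_card big_mkcond /=.
rewrite -(pair_bigA _ (fun i j : 'I_3 =>
  if (i, j) \in [pred p : 'I_3 * 'I_3 | (p.1 < p.2)%N && (s p.2 < s p.1)%N]
  then 1%N else 0%N)) /=.
rewrite !big_I3 !inE /= !add0n !addn0.
by do 3!case: (_ < _)%N.
Qed.

Lemma sum_S3 (V : zmodType) (F : nat -> 'I_3 -> 'I_3 -> 'I_3 -> V) :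
  \sum_(s : 'S_3) F (inversions s) (s i1) (s i2) (s i3) =
  F 0 i1 i2 i3 + F 1 i2 i1 i3 + F 1 i1 i3 i2 + F 2 i2 i3 i1 + F 2 i3 i1 i2
  + F 3 i3 i2 i1.
Proof.
pose L : seq 'S_3 := [:: 1%g; tperm i1 i2; tperm i2 i3;
  (tperm i1 i2 * tperm i1 i3)%g; (tperm i1 i3 * tperm i1 i2)%g; tperm i1 i3].
have pE := (permM, perm1, permE).
have uL : uniq L.
  apply: (@map_uniq _ _ (fun s : 'S_3 => (s i1, s i2))).
  by rewrite /= !pE.
have [||_ LE] := @uniq_min_size _ L (enum 'S_3) uL.
- by move=> s _; rewrite mem_enum.
- by rewrite -cardE card_Sn.
have pL : perm_eq (index_enum 'S_3) L.
  apply: uniq_perm => //; first exact: index_enum_uniq.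
  by move=> s; rewrite LE mem_enum mem_index_enum.
rewrite (perm_big _ pL) /= !big_cons big_nil addr0 !addrA.
by rewrite !inversions3 !pE.
Qed.

Section QMatrix.
Variables (K : fieldType) (q : K).

Record is_qmatrix (B : algType K) (x : 'I_3 -> 'I_3 -> B) : Prop := {
  qm_col : forall i l j : 'I_3, (i < l)%N ->
    x i j * x l j = q *: (x l j * x i j);
  qm_row : forall i j k : 'I_3, (j < k)%N ->
    x i j * x i k = q *: (x i k * x i j);
  qm_comm : forall i l j k : 'I_3, (i < l)%N -> (j < k)%N ->
    x i k * x l j = x l j * x i k;
  qm_cross : forall i l j k : 'I_3, (i < l)%N -> (j < k)%N ->
    x i j * x l k = x l k * x i j + (q - q^-1) *: (x i k * x l j)
}.

Record is_glq (B : algType K) (x : 'I_3 -> 'I_3 -> B) (d : B) : Prop := {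
  glq_qm : is_qmatrix x;
  glq_central : forall i j, d * x i j = x i j * d;
  glq_inv : qdet q x * d = 1
}.

Lemma delta_glq : is_glq (fun i j => ((i == j)%:R : K^o)) 1.
Proof.
split; first split.
- move=> i l j il; have [ij|] := eqVneq i j; last by rewrite mul0r mulr0 scaler0.
  by subst j; rewrite [l == i](gtn_eqF il) mul0r mulr0 scaler0.
- move=> i j k jk; have [ij|] := eqVneq i j; last by rewrite mul0r mulr0 scaler0.
  by subst j; rewrite [i == k](ltn_eqF jk) mul0r mulr0 scaler0.
- by move=> *; rewrite mulrC.
- move=> i l j k il jk; rewrite mulrC [X in _ + _ *: X](_ : _ = 0).
    by rewrite scaler0 addr0.
  have [ik|] := eqVneq i k; last by rewrite mul0r.
  have [lj|] := eqVneq l j; last by rewrite mulr0.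
  by move: il; rewrite ik lj ltnNge (ltnW jk).
- by move=> *; rewrite mul1r mulr1.
rewrite /qdet (sum_S3 (fun n a b c => (- q) ^+ n *:
  (((i1 == a)%:R : K^o) * (i2 == b)%:R * (i3 == c)%:R))) /=.
by rewrite expr0 scale1r !mulr1 !(mul0r, mulr0, scaler0, addr0).
Qed.

(* Linear identities between elements of a [K]-module, by comparing the
   coefficients of the given atoms. *)
Inductive lexp := LV of nat | LZ | LN of lexp | LA of lexp & lexp | LS of K & lexp.
Fixpoint ldenote (V : lmodType K) (vs : seq V) e : V :=
  match e with
  | LV n => nth 0 vs n
  | LZ => 0
  | LN e => - ldenote vs e
  | LA e f => ldenote vs e + ldenote vs f
  | LS c e => c *: ldenote vs e
  end.
Fixpoint lcoef e (n : nat) : K :=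
  match e with
  | LV m => if m == n then 1 else 0
  | LZ => 0
  | LN e => - lcoef e n
  | LA e f => lcoef e n + lcoef f n
  | LS c e => c * lcoef e n
  end.
Fixpoint lcoef_eq e f n : Prop :=
  if n is n'.+1 then lcoef e n' = lcoef f n' /\ lcoef_eq e f n' else True.

Lemma ldenoteE (V : lmodType K) (vs : seq V) e :
  ldenote vs e = \sum_(n < size vs) lcoef e n *: nth 0 vs n.
Proof.
elim: e => [m||e IHe|e IHe f IHf|c e IHe] /=.
- have [lt_m|le_m] := ltnP m (size vs); last first.
    rewrite nth_default // big1 // => n _.
    by rewrite gtn_eqF ?scale0r // (leq_trans (ltn_ord n)).
  rewrite (bigD1 (Ordinal lt_m)) //= eqxx scale1r big1 ?addr0 // => n nm.
  by rewrite ifN ?scale0r // eq_sym.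
- by rewrite big1 // => n _; rewrite scale0r.
- by rewrite IHe -sumrN; apply: eq_bigr => n _; rewrite scaleNr.
- by rewrite IHe IHf -big_split; apply: eq_bigr => n _; rewrite scalerDl.
- by rewrite IHe scaler_sumr; apply: eq_bigr => n _; rewrite scalerA.
Qed.

Lemma lcoef_eqP (V : lmodType K) (vs : seq V) e f :
  lcoef_eq e f (size vs) -> ldenote vs e = ldenote vs f.
Proof.
rewrite !ldenoteE => ef; apply: eq_bigr => -[n /= ltn] _; congr (_ *: _).
elim: (size vs) ltn ef => //= m IHm; rewrite ltnS leq_eqVlt.
by case/orP=> [/eqP-> []|/IHm ih [_]].
Qed.

End QMatrix.

Ltac lindex v vs :=
  match vs with
  | ?w :: _ => let _ := match goal with _ => unify v w end in constr:(0%N)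
  | _ :: ?ws => let n := lindex v ws in constr:(S n)
  end.
Ltac lreify K vs e :=
  lazymatch e with
  | ?a + ?b => let a' := lreify K vs a in let b' := lreify K vs b in
               constr:(LA a' b')
  | - ?a => let a' := lreify K vs a in constr:(LN a')
  | ?c *: ?a => let a' := lreify K vs a in constr:(LS c a')
  | 0 => constr:(LZ K)
  | _ => let n := lindex e vs in constr:(LV K n)
  end.
Ltac lmod K vs :=
  lazymatch goal with
  | |- ?a = ?b =>
      let a' := lreify K vs a in let b' := lreify K vs b in
      apply: (@lcoef_eqP _ _ vs a' b'); rewrite /=; repeat split
  end.

Section QMatrixTheory.
Variables (K : fieldType) (q : K) (B : algType K).
Hypothesis q_neq0 : q != 0.
Implicit Types x y : 'I_3 -> 'I_3 -> B.

Lemma sum_sym (V : zmodType) (F G : 'I_3 -> 'I_3 -> V) :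
  (forall p, F p p = G p p) ->
  (forall p r : 'I_3, (p < r)%N -> F p r + F r p = G p r + G r p) ->
  \sum_p \sum_r F p r = \sum_p \sum_r G p r.
Proof.
move=> Fd Fo.
have E (H : 'I_3 -> 'I_3 -> V) : \sum_p \sum_r H p r =
    H i1 i1 + H i2 i2 + H i3 i3 + (H i1 i2 + H i2 i1)
    + (H i1 i3 + H i3 i1) + (H i2 i3 + H i3 i2).
  rewrite !big_I3 /= [in LHS]addrA !addrA.
  by rewrite [LHS](+%R.[ACl 1*5*9*2*4*3*7*6*8]).
by rewrite !E !Fd !Fo.
Qed.

Section Product.
Variables x y : 'I_3 -> 'I_3 -> B.
Hypotheses (xq : is_qmatrix q x) (yq : is_qmatrix q y).
Hypothesis xy : forall i j k l, y i j * x k l = x k l * y i j.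

Let z i j := \sum_p x i p * y p j.

Let zM i j l k :
  z i j * z l k = \sum_p \sum_r (x i p * x l r) * (y p j * y r k).
Proof.
rewrite /z mulr_suml; apply: eq_bigr => p _; rewrite mulr_sumr.
by apply: eq_bigr => r _; rewrite -!mulrA (mulrA (y p j)) xy !mulrA.
Qed.

Let scale_sum2 c (F : 'I_3 -> 'I_3 -> B) :
  c *: (\sum_p \sum_r F p r) = \sum_p \sum_r c *: F p r.
Proof.
by rewrite scaler_sumr; apply: eq_bigr => p _; rewrite scaler_sumr.
Qed.

Ltac expand := rewrite ?mulrDl ?mulrDr -?scalerAl -?scalerAr.

Lemma qmatrix_mul : is_qmatrix q z.
Proof.
have [xc xr xm xx] := xq; have [yc yr ym yx] := yq.
split.
- move=> i l j il; rewrite !zM scale_sum2; apply: sum_sym => [p|p r pr].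
    by rewrite xc //; expand.
  rewrite (xx i l p r) // (xm i l p r) // (yc p r j) //; expand.
  lmod K [:: x l r * x i p * (y r j * y p j); x l p * x i r * (y r j * y p j)];
    by field.
- move=> i j k jk; rewrite !zM scale_sum2; apply: sum_sym => [p|p r pr].
    by rewrite yr //; expand.
  rewrite (xr i p r) // (yx p r j k) // (ym p r j k) //; expand.
  lmod K [:: x i r * x i p * (y r k * y p j); x i r * x i p * (y r j * y p k)];
    by field.
- move=> i l j k il jk; rewrite !zM; apply: sum_sym => [p|p r pr].
    by rewrite (xc i l p) // (yr p j k) //; expand.
  rewrite (xx i l p r) // (xm i l p r) // (yx p r j k) // (ym p r j k) //.
  expand.
  lmod K [:: x l r * x i p * (y r j * y p k); x l p * x i r * (y r j * y p k);
    x l p * x i r * (y r k * y p j)]; by field.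
move=> i l j k il jk; rewrite !zM scale_sum2 -big_split /=.
under [in RHS]eq_bigr do rewrite -big_split /=.
apply: sum_sym => [p|p r pr].
  rewrite (xc i l p) // (yr p j k) //; expand; lmod K [:: x l p * x i p * (y p k * y p j)].
  by field.
rewrite (xx i l p r) // (xm i l p r) // (yx p r j k) // (ym p r j k) //.
expand.
lmod K [:: x l r * x i p * (y r j * y p k); x l p * x i r * (y r j * y p k);
  x l p * x i r * (y r k * y p j); x l r * x i p * (y r k * y p j)]; by field.
Qed.
End Product.
End QMatrixTheory.

Section QDetTheory.
Variables (K : fieldType) (q : K) (B : algType K).
Hypothesis q_neq0 : q != 0.
Implicit Types x y : 'I_3 -> 'I_3 -> B.

Definition row_qdet x (a b c : 'I_3) : B := qdet q (fun i =>
  x (if i == i1 then a else if i == i2 then b else c)).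

Definition qminor x (a b j k : 'I_3) : B :=
  x a j * x b k - q *: (x a k * x b j).

Lemma row_qdetE x a b c : row_qdet x a b c =
  x a i1 * x b i2 * x c i3 + (- q) *: (x a i2 * x b i1 * x c i3)
  + (- q) *: (x a i1 * x b i3 * x c i2) + q ^+ 2 *: (x a i2 * x b i3 * x c i1)
  + q ^+ 2 *: (x a i3 * x b i1 * x c i2)
  + (- q ^+ 3) *: (x a i3 * x b i2 * x c i1).
Proof.
rewrite /row_qdet /qdet (sum_S3 (fun n j k l =>
  (- q) ^+ n *: (x a j * x b k * x c l))).
by rewrite expr0 expr1 scale1r sqrrN; congr (_ + _ *: _); ring.
Qed.

Lemma qdetE x : qdet q x = row_qdet x i1 i2 i3.
Proof. by []. Qed.

Lemma row_qdetEl x a b c : row_qdet x a b c =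
  qminor x a b i1 i2 * x c i3 - q *: (qminor x a b i1 i3 * x c i2)
  + q ^+ 2 *: (qminor x a b i2 i3 * x c i1).
Proof.
rewrite row_qdetE /qminor !mulrBl -!scalerAl.
lmod K [:: x a i1 * x b i2 * x c i3; x a i2 * x b i1 * x c i3;
  x a i1 * x b i3 * x c i2; x a i2 * x b i3 * x c i1;
  x a i3 * x b i1 * x c i2; x a i3 * x b i2 * x c i1]; by ring.
Qed.

Lemma row_qdetEr x a b c : row_qdet x a b c =
  x a i1 * qminor x b c i2 i3 - q *: (x a i2 * qminor x b c i1 i3)
  + q ^+ 2 *: (x a i3 * qminor x b c i1 i2).
Proof.
rewrite row_qdetE /qminor !mulrBr -!scalerAr !mulrA.
lmod K [:: x a i1 * x b i2 * x c i3; x a i2 * x b i1 * x c i3;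
  x a i1 * x b i3 * x c i2; x a i2 * x b i3 * x c i1;
  x a i3 * x b i1 * x c i2; x a i3 * x b i2 * x c i1]; by ring.
Qed.

Section Alternating.
Variable x : 'I_3 -> 'I_3 -> B.
Hypothesis xq : is_qmatrix q x.

Lemma qminor_swap (a b j k : 'I_3) : (a < b)%N -> (j < k)%N ->
  qminor x b a j k = - q *: qminor x a b j k.
Proof.
move=> ab jk; rewrite /qminor (qm_cross xq ab jk) (qm_comm xq ab jk).
by lmod K [:: x b j * x a k; x b k * x a j]; field.
Qed.

Lemma qminor_diag (a j k : 'I_3) : (j < k)%N -> qminor x a a j k = 0.
Proof. by move=> jk; rewrite /qminor (qm_row xq _ jk) subrr. Qed.

Lemma row_qdet_swapl (a b c : 'I_3) : (a < b)%N ->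
  row_qdet x b a c = - q *: row_qdet x a b c.
Proof.
move=> ab; rewrite !row_qdetEl !(qminor_swap ab) // -!scalerAl.
by lmod K [:: qminor x a b i1 i2 * x c i3; qminor x a b i1 i3 * x c i2;
  qminor x a b i2 i3 * x c i1]; ring.
Qed.

Lemma row_qdet_swapr (a b c : 'I_3) : (b < c)%N ->
  row_qdet x a c b = - q *: row_qdet x a b c.
Proof.
move=> bc; rewrite !row_qdetEr !(qminor_swap bc) // -!scalerAr.
by lmod K [:: x a i1 * qminor x b c i2 i3; x a i2 * qminor x b c i1 i3;
  x a i3 * qminor x b c i1 i2]; ring.
Qed.

Lemma row_qdet_diagl a c : row_qdet x a a c = 0.
Proof. by rewrite row_qdetEl !qminor_diag // !(mul0r, scaler0, subrr, addr0). Qed.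

Lemma row_qdet_diagr a b : row_qdet x a b b = 0.
Proof. by rewrite row_qdetEr !qminor_diag // !(mulr0, scaler0, subrr, addr0). Qed.
End Alternating.

Lemma qdet_mul x y :
  is_qmatrix q x -> is_qmatrix q y ->
  (forall i j k l, y i j * x k l = x k l * y i j) ->
  qdet q (fun i j => \sum_p x i p * y p j) = qdet q x * qdet q y.
Proof.
move=> xq yq xy.
transitivity (\sum_a \sum_b \sum_c
    (x i1 a * x i2 b * x i3 c) * row_qdet y a b c).
  rewrite /row_qdet /qdet; under [RHS]eq_bigr => a _.
    under eq_bigr => b _ do [under eq_bigr => c _ do rewrite mulr_sumr;
                             rewrite exchange_big].
    rewrite exchange_big; over.
  rewrite exchange_big; apply: eq_bigr => s _ /=.
  rewrite !mulr_suml scaler_sumr; apply: eq_bigr => a _.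
  rewrite -mulrA mulr_suml mulr_sumr scaler_sumr; apply: eq_bigr => b _.
  rewrite !mulr_sumr scaler_sumr; apply: eq_bigr => c _.
  rewrite -scalerAr; congr (_ *: _) => /=; rewrite -!mulrA.
  rewrite (mulrA (y a _) (x i2 b)) xy -mulrA.
  rewrite (mulrA (y b _) (x i3 c)) xy -mulrA.
  by rewrite (mulrA (y a _) (x i3 c)) xy -mulrA.
rewrite !big_I3 /= !(row_qdet_diagl yq, row_qdet_diagr yq).
rewrite (row_qdet_swapl yq (a := i2) (b := i3) i1 isT).
rewrite (row_qdet_swapl yq (a := i1) (b := i3) i2 isT).
rewrite (row_qdet_swapl yq (a := i1) (b := i3) i3 isT).
rewrite (row_qdet_swapl yq (a := i2) (b := i3) i3 isT).
rewrite (row_qdet_swapl yq (a := i1) (b := i2) i2 isT).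
rewrite (row_qdet_swapr yq i1 (b := i1) (c := i2) isT).
rewrite (row_qdet_swapr yq i1 (b := i1) (c := i3) isT).
rewrite (row_qdet_swapr yq i2 (b := i1) (c := i3) isT).
rewrite (row_qdet_swapr yq i2 (b := i2) (c := i3) isT).
rewrite (row_qdet_swapl yq (a := i1) (b := i2) i3 isT).
rewrite (row_qdet_swapr yq i1 (b := i2) (c := i3) isT).
rewrite !(row_qdet_diagl yq, row_qdet_diagr yq).
rewrite [qdet q x]qdetE [qdet q y]qdetE [row_qdet x _ _ _]row_qdetE.
move: (row_qdet y _ _ _) => D.
rewrite !(scaler0, mulr0, add0r, addr0) !mulrDl -!scalerAl -!scalerAr.
lmod K [:: x i1 i1 * x i2 i2 * x i3 i3 * D; x i1 i2 * x i2 i1 * x i3 i3 * D;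
  x i1 i1 * x i2 i3 * x i3 i2 * D; x i1 i2 * x i2 i3 * x i3 i1 * D;
  x i1 i3 * x i2 i1 * x i3 i2 * D; x i1 i3 * x i2 i2 * x i3 i1 * D]; by ring.
Qed.

End QDetTheory.

(* [Gdetinv] is the inverse of the quantum determinant. *)
Inductive glgen := Gx of 'I_3 & 'I_3 | Gdetinv.

Section GLqTerms.
Variables (K : fieldType) (q : K).
Local Notation term := (ncterm K glgen).
Local Notation X i j := (Gen (Gx i j) : term).

Definition qdet_term : term :=
  \big[@Add K glgen/Cst 0]_(s : 'S_3)
    Mul (Cst ((- q) ^+ inversions s))
        (Mul (Mul (X i1 (s i1)) (X i2 (s i2))) (X i3 (s i3))).

Inductive glq_rel : term -> term -> Prop :=
  | glq_col (i l j : 'I_3) : (i < l)%N ->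
      glq_rel (Mul (X i j) (X l j)) (Mul (Cst q) (Mul (X l j) (X i j)))
  | glq_row (i j k : 'I_3) : (j < k)%N ->
      glq_rel (Mul (X i j) (X i k)) (Mul (Cst q) (Mul (X i k) (X i j)))
  | glq_comm (i l j k : 'I_3) : (i < l)%N -> (j < k)%N ->
      glq_rel (Mul (X i k) (X l j)) (Mul (X l j) (X i k))
  | glq_cross (i l j k : 'I_3) : (i < l)%N -> (j < k)%N ->
      glq_rel (Mul (X i j) (X l k))
              (Add (Mul (X l k) (X i j))
                   (Mul (Cst (q - q^-1)) (Mul (X i k) (X l j))))
  | glq_detinv_central (i j : 'I_3) :
      glq_rel (Mul (Gen Gdetinv) (X i j)) (Mul (X i j) (Gen Gdetinv))
  | glq_detinv : glq_rel (Mul qdet_term (Gen Gdetinv)) (Cst 1).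

Lemma nceval_qdet (B : algType K) (f : glgen -> B) :
  nceval f qdet_term = qdet q (fun i j => f (Gx i j)).
Proof.
rewrite /qdet_term /qdet (big_morph (nceval f) (id1 := 0) (op1 := +%R)) //=.
  by apply: eq_bigr => s _; rewrite -scalerAl mul1r.
by rewrite scale0r.
Qed.

Lemma glq_relP (B : algType K) (f : glgen -> B) :
  is_glq q (fun i j => f (Gx i j)) (f Gdetinv) ->
  forall t u, glq_rel t u -> nceval f t = nceval f u.
Proof.
case=> -[fc fr fm fx] fd fi t u [] * //=; rewrite -?scalerAl ?mul1r; auto.
by rewrite nceval_qdet fi scale1r.
Qed.

Definition OGLq := presented glq_rel.
HB.instance Definition _ := GRing.PzRing.on OGLq.
HB.instance Definition _ := GRing.Lmodule.on OGLq.

Definition glcls (t : term) : OGLq := pcls glq_rel t.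

Definition counit_gen (g : glgen) : K^o :=
  match g with Gx i j => (i == j)%:R | Gdetinv => 1 end.

Definition counit (a : OGLq) : K^o := nceval counit_gen (repr a).

Lemma counitE t : counit (glcls t) = nceval counit_gen t.
Proof.
apply: (@nceval_cong _ _ glq_rel); last exact: repr_pcls.
by apply: glq_relP; apply: delta_glq.
Qed.

Let OGLq_one_neq0 : (1 : OGLq) != 0.
Proof.
apply/eqP => /(congr1 counit).
rewrite -[1]/(glcls (Cst 1)) -[0]/(glcls (Cst 0)) !counitE /=.
by rewrite scale0r scale1r; apply/eqP/oner_neq0.
Qed.
HB.instance Definition _ :=
  GRing.PzSemiRing_isNonZero.Build OGLq OGLq_one_neq0.
HB.instance Definition _ := GRing.Lmodule_isLalgebra.Build K OGLq
  (@presented_scalerAl K glgen glq_rel).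
HB.instance Definition _ := GRing.Lalgebra_isAlgebra.Build K OGLq
  (@presented_scalerAr K glgen glq_rel).

Definition glx (i j : 'I_3) : OGLq := glcls (Gen (Gx i j)).
Definition detinv : OGLq := glcls (Gen Gdetinv).

Definition gl_gen (g : glgen) : OGLq := glcls (Gen g).

Lemma nceval_glcls t : nceval gl_gen t = glcls t.
Proof.
elim: t => //= [c|t -> u ->|t -> u ->]; first by rewrite /glcls pclsC.
  by rewrite /glcls pclsD.
by rewrite /glcls pclsM.
Qed.

Lemma OGLq_glq : is_glq q glx detinv.
Proof.
have relE t u : glq_rel t u -> nceval gl_gen t = nceval gl_gen u.
  by move=> tu; rewrite !nceval_glcls; apply/pclsP/nc_rel.
split; first split.
- move=> i l j il; have /= := relE _ _ (glq_col j il).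
  by rewrite -scalerAl mul1r.
- move=> i j k jk; have /= := relE _ _ (glq_row i jk).
  by rewrite -scalerAl mul1r.
- by move=> i l j k il jk; have /= := relE _ _ (glq_comm il jk).
- move=> i l j k il jk; have /= := relE _ _ (glq_cross il jk).
  by rewrite -scalerAl mul1r.
- by move=> i j; have /= := relE _ _ (glq_detinv_central i j).
by have /= := relE _ _ glq_detinv; rewrite nceval_qdet scale1r.
Qed.

Definition comul_gen (g : glgen) : tsq OGLq :=
  match g with
  | Gx i j => \sum_p tens (glx i p) (glx p j)
  | Gdetinv => tens detinv detinv
  end.

(* This does not depend on the chosen representative, see [comulE]. *)
Definition comul (a : OGLq) : tsq OGLq := nceval comul_gen (repr a).

(* The maps [id (x) h] and [h (x) id]. *)
Definition slice_r (h : {scalar OGLq}) : tsq OGLq -> OGLq :=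
  tlift (fun a b => h b *: a).
Definition slice_l (h : {scalar OGLq}) : tsq OGLq -> OGLq :=
  tlift (fun a b => h a *: b).

Definition is_haar_state (h : {scalar OGLq}) : Prop :=
  h 1 = 1 /\
  forall x, slice_r h (comul x) = h x *: 1 /\ slice_l h (comul x) = h x *: 1.

Lemma slice_r_bil (h : {scalar OGLq}) :
  is_bilinear (fun a b : OGLq => h b *: a).
Proof.
split=> [a|b] c u v /=; first by rewrite linearP scalerDl scalerA.
by rewrite scalerDr !scalerA mulrC.
Qed.

Lemma slice_l_bil (h : {scalar OGLq}) :
  is_bilinear (fun a b : OGLq => h a *: b).
Proof.
split=> [a|b] c u v /=; last by rewrite linearP scalerDl scalerA.
by rewrite scalerDr !scalerA mulrC.
Qed.

Lemma haar_state_unique (h h' : {scalar OGLq}) :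
  is_haar_state h -> is_haar_state h' -> h =1 h'.
Proof.
move=> [h1 hP] [h'1 h'P] x.
have E : h (slice_r h' (comul x)) = h' (slice_l h (comul x)).
  rewrite /slice_r /slice_l /tlift /fsum !linear_sum.
  by apply: eq_bigr => p _; rewrite !linearZ /= mulrC.
by move: E; rewrite (h'P x).1 (hP x).2 !linearZ /= h1 h'1 !mulr1.
Qed.

Section Comul.
Hypothesis q_neq0 : q != 0.

Lemma comul_gen_glq :
  is_glq q (fun i j => comul_gen (Gx i j)) (comul_gen Gdetinv).
Proof.
have [xq dC dI] := OGLq_glq.
have tD := tens_bilinear OGLq.
pose x i j : tsq OGLq := tens (glx i j) 1.
pose y i j : tsq OGLq := tens 1 (glx i j).
have xE : is_qmatrix q x.
  case: xq => xc xr xm xx.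
  split=> [i l j il|i j k jk|i l j k il jk|i l j k il jk];
    rewrite /x !tensM ?mulr1.
  - by rewrite xc // (bilZl tD).
  - by rewrite xr // (bilZl tD).
  - by rewrite xm.
  - by rewrite xx // (bilDl tD) (bilZl tD).
have yE : is_qmatrix q y.
  case: xq => xc xr xm xx.
  split=> [i l j il|i j k jk|i l j k il jk|i l j k il jk];
    rewrite /y !tensM ?mulr1.
  - by rewrite xc // (bilZr tD).
  - by rewrite xr // (bilZr tD).
  - by rewrite xm.
  - by rewrite xx // (bilDr tD) (bilZr tD).
have xy i j k l : y i j * x k l = x k l * y i j.
  by rewrite /x /y !tensM !mulr1 !mul1r.
have zE : (fun i j => comul_gen (Gx i j)) = fun i j => \sum_p x i p * y p j.
  apply/funext => i; apply/funext => j; apply: eq_bigr => p _.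
  by rewrite /x /y tensM mulr1 mul1r.
split; first by rewrite zE; apply: qmatrix_mul.
- move=> i j /=; rewrite mulr_sumr mulr_suml; apply: eq_bigr => p _.
  by rewrite !tensM !dC.
have detl : qdet q x = tens (qdet q glx) 1.
  pose f (a : OGLq) := tens a 1.
  rewrite /qdet -[RHS]/(f _) (big_morph f (id1 := 0) (op1 := +%R)).
  - by apply: eq_bigr => s _; rewrite /f (bilZl tD) /x !tensM !mulr1.
  - by move=> a b; rewrite /f (bilDl tD).
  - by rewrite /f (bil0l tD).
have detr : qdet q y = tens 1 (qdet q glx).
  pose f (a : OGLq) := tens 1 a.
  rewrite /qdet -[RHS]/(f _) (big_morph f (id1 := 0) (op1 := +%R)).
  - by apply: eq_bigr => s _; rewrite /f (bilZr tD) /y !tensM !mulr1.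
  - by move=> a b; rewrite /f (bilDr tD).
  - by rewrite /f (bil0r tD).
by rewrite zE qdet_mul // detl detr /= !tensM mulr1 mul1r dI tens1.
Qed.

Lemma comulE t : comul (glcls t) = nceval comul_gen t.
Proof.
apply: (nceval_cong (rel := glq_rel)); last exact: repr_pcls.
by apply: glq_relP; apply: comul_gen_glq.
Qed.

Let OGLq_ind (P : OGLq -> Prop) :
  (forall t, P (glcls t)) -> forall a, P a.
Proof. by move=> Pt a; rewrite -(pclsK a); apply: Pt. Qed.

Lemma comul1 : comul 1 = 1.
Proof. by rewrite -[1]/(glcls (Cst 1)) comulE /= scale1r. Qed.

Lemma comulM a b : comul (a * b) = comul a * comul b.
Proof.
elim/OGLq_ind: a => t; elim/OGLq_ind: b => u.
by rewrite -pclsM -/(glcls _) !comulE.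
Qed.

Lemma comul_linear : linear comul.
Proof.
move=> c a b; elim/OGLq_ind: a => t; elim/OGLq_ind: b => u.
by rewrite -pclsZ -pclsD -/(glcls _) !comulE /= -scalerAl mul1r.
Qed.

Lemma comul_glx i j : comul (glx i j) = \sum_p tens (glx i p) (glx p j).
Proof. exact: comulE. Qed.

Lemma comul_detinv : comul detinv = tens detinv detinv.
Proof. exact: comulE. Qed.
End Comul.

End GLqTerms.

(* The entries a, b, c / d, e, f / g, h, k of the matrix of generators. *)
Definition xa (K : fieldType) (q : K) : OGLq q := glx q i1 i1.
Definition xb (K : fieldType) (q : K) : OGLq q := glx q i1 i2.
Definition xc (K : fieldType) (q : K) : OGLq q := glx q i1 i3.
Definition xd (K : fieldType) (q : K) : OGLq q := glx q i2 i1.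
Definition xe (K : fieldType) (q : K) : OGLq q := glx q i2 i2.
Definition xf (K : fieldType) (q : K) : OGLq q := glx q i2 i3.
Definition xg (K : fieldType) (q : K) : OGLq q := glx q i3 i1.
Definition xh (K : fieldType) (q : K) : OGLq q := glx q i3 i2.
Definition xk (K : fieldType) (q : K) : OGLq q := glx q i3 i3.

Definition qpoch (K : fieldType) (x p : K) (N : nat) : K :=
  \prod_(i < N) (1 - x * p ^+ i).

Definition qbinom (K : fieldType) (p : K) (N j : nat) : K :=
  if (j <= N)%N then qpoch p p N / (qpoch p p j * qpoch p p (N - j)) else 0.

(* Meant for [N = N1 + N2 + N3]. *)
Definition qmultinom (K : fieldType) (p : K) (N N1 N2 N3 : nat) : K :=
  qpoch p p N / (qpoch p p N1 * qpoch p p N2 * qpoch p p N3).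

(* Main.v *)
Require Import Defs.
From mathcomp Require Import all_boot all_order all_algebra.
From mathcomp Require Import reals complex ring zify.

Set Implicit Arguments.
Unset Strict Implicit.
Unset Printing Implicit Defensive.

Import GRing.Theory.
Local Open Scope ring_scope.
Local Open Scope complex_scope.

(* Pairing one leg of the coproduct with the off-diagonal entry of an algebra
   map from O(GL_q(3)) to upper triangular 2 x 2 matrices gives a skew derivation
   (the action of an E_i or F_i of U_q(gl_3)) moving the entries of one column to
   an adjacent one.  Invariance makes the Haar state vanish on its image; on a
   row-ordered monomial this is a relation between three values of the Haar
   state.  These relations recursively express all the values of degree
   (m, m, m) by h(c^m e^m g^m det^-m), and the sum in the theorem satisfies them
   because, after two q-Pascal steps, the three sums match term by term.
   The normalisation comes from inserting det_q det_q^-1 = 1 between d^m and h^m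
   in c^m d^m h^m det_q^-m: no reordering of cross terms is then needed, and six
   values of degree m + 1 give the value of degree m. *)

(** * Powers of q-commuting elements *)

Section QCommutation.
Variables (K : fieldType) (A : algType K).

Lemma qcommV (c : K) (a b : A) :
  c != 0 -> a * b = c *: (b * a) -> b * a = c^-1 *: (a * b).
Proof. by move=> c0 ->; rewrite scalerA mulVf // scale1r. Qed.

Lemma qcomm_expl (c : K) (a b : A) n :
  b * a = c *: (a * b) -> b ^+ n * a = c ^+ n *: (a * b ^+ n).
Proof.
move=> ba; elim: n => [|n IHn]; first by rewrite !expr0 scale1r mulr1 mul1r.
rewrite [in LHS]exprSr -[LHS]mulrA ba -scalerAr [X in c *: X]mulrA IHn.
by rewrite -scalerAl scalerA -mulrA -exprSr -exprS.
Qed.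

Lemma qcomm_expr (c : K) (a b : A) n :
  a * b = c *: (b * a) -> a * b ^+ n = c ^+ n *: (b ^+ n * a).
Proof.
move=> ab; elim: n => [|n IHn]; first by rewrite !expr0 scale1r mulr1 mul1r.
rewrite [in LHS]exprS [LHS]mulrA ab -scalerAl -[X in c *: X]mulrA IHn.
by rewrite -scalerAr scalerA mulrA -!exprS.
Qed.

End QCommutation.

(** * Arithmetic of upper triangular 2 x 2 matrices *)

Section UpperTriangular.
Variable K : fieldType.

Definition utmx (a e b : K) : 'M[K]_2 :=
  \matrix_(i, j) if i == 0 then (if j == 0 then a else e)
                 else (if j == 0 then 0 else b).

Lemma utmxM a e b a' e' b' :
  utmx a e b * utmx a' e' b' = utmx (a * a') (a * e' + e * b') (b * b').
Proof.
apply/matrixP => i j; rewrite !mxE !big_ord_recl big_ord0 !mxE.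
by case: i => [[|[|//]] ?]; case: j => [[|[|//]] ?] /=; ring.
Qed.

Lemma utmxD a e b a' e' b' :
  utmx a e b + utmx a' e' b' = utmx (a + a') (e + e') (b + b').
Proof.
apply/matrixP => i j; rewrite !mxE.
by case: i => [[|[|//]] ?]; case: j => [[|[|//]] ?] /=; ring.
Qed.

Lemma utmxZ c a e b : c *: utmx a e b = utmx (c * a) (c * e) (c * b).
Proof.
apply/matrixP => i j; rewrite !mxE.
by case: i => [[|[|//]] ?]; case: j => [[|[|//]] ?] /=; ring.
Qed.

Lemma utmx1 : 1 = utmx 1 0 1.
Proof.
apply/matrixP => i j; rewrite !mxE.
by case: i => [[|[|//]] ?]; case: j => [[|[|//]] ?] /=.
Qed.
End UpperTriangular.

(** * Skew derivations of O(GL_q(3)) and their annihilation by the Haar state *)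

Section Derivation.
Variables (K : fieldType) (q : K).
Hypothesis q_neq0 : q != 0.
Variables (mu : 'I_3 -> K) (p0 j0 : 'I_3).

(* The diagonal characters are the counit and a twist [mu] of it; the factor
   [1 - q ^- 2] clears the denominators of the q-integers. *)
Definition der_gen (g : glgen) : 'M[K]_2 :=
  match g with
  | Gx i j => utmx (i == j)%:R (((i == p0) && (j == j0))%:R * (1 - q ^- 2))
                   ((i == j)%:R * mu j)
  | Gdetinv => 1
  end.

(** By the presentation of O(GL_q(3)), this is what makes [der_gen] extend to an algebra map. *)
Definition der_compatible :=
  is_glq q (fun i j => der_gen (Gx i j)) (der_gen Gdetinv).
Hypothesis derP : der_compatible.

Definition der_rho (a : OGLq q) : 'M[K]_2 := nceval der_gen (repr a).

Lemma der_rhoE t : der_rho (glcls q t) = nceval der_gen t.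
Proof.
apply: (nceval_cong (rel := glq_rel q)); last exact: repr_pcls.
exact: glq_relP.
Qed.

Lemma glcls_ind (P : OGLq q -> Prop) :
  (forall t, P (glcls q t)) -> forall a, P a.
Proof. by move=> Pt a; rewrite -(pclsK a); apply: Pt. Qed.

Lemma der_rhoM a b : der_rho (a * b) = der_rho a * der_rho b.
Proof.
elim/glcls_ind: a => t; elim/glcls_ind: b => u.
by rewrite -pclsM -/(glcls _ _) !der_rhoE.
Qed.

Lemma der_rho_linear : linear der_rho.
Proof.
move=> c a b; elim/glcls_ind: a => t; elim/glcls_ind: b => u.
by rewrite -pclsZ -pclsD -/(glcls _ _) !der_rhoE /= -scalerAl mul1r.
Qed.

Lemma der_rho1 : der_rho 1 = 1.
Proof. by rewrite -[1 in LHS]/(glcls q (Cst 1)) der_rhoE /= scale1r. Qed.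

Lemma der_rho_glx i j : der_rho (glx q i j) = der_gen (Gx i j).
Proof. exact: der_rhoE. Qed.

Lemma der_rho_detinv : der_rho (detinv q) = 1.
Proof. exact: der_rhoE. Qed.

(** The left action x -> x_(1) rho_ij(x_(2)) of a matrix coefficient of [der_rho]. *)
Definition der_map (i j : 'I_2) (x : OGLq q) : OGLq q :=
  tlift (fun a b => der_rho b i j *: a) (comul x).

Lemma der_bil i j :
  is_bilinear (fun a b : OGLq q => der_rho b i j *: a).
Proof.
split=> [a|b] c u v /=; first by rewrite der_rho_linear !mxE scalerDl scalerA.
by rewrite scalerDr !scalerA mulrC.
Qed.

Lemma tlift_sum (U : lmodType K) (f : OGLq q -> OGLq q -> U) (I : Type)
    (s : seq I) (F : I -> tsq (OGLq q)) : is_bilinear f ->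
  tlift f (\sum_(i <- s) F i) = \sum_(i <- s) tlift f (F i).
Proof.
move=> fb; have fl := tlift_linear fb.
have f0 : tlift f 0 = 0.
  by have := fl (-1) 0 0; rewrite scaleN1r addNr scaleN1r addNr.
apply: (big_morph (tlift f)) => // x y.
by have := fl 1 x y; rewrite !scale1r.
Qed.

Lemma comul_sumE (x : OGLq q) :
  comul x = \sum_(p <- repr (comul x)) tens p.1 p.2.
Proof. by rewrite -tclsE tclsK. Qed.

(** Both the coproduct and [der_rho] are multiplicative, so the four maps are the entries of an
    algebra map into 2 x 2 matrices over O(GL_q(3)). *)
Lemma der_mapM i j x y :
  der_map i j (x * y) = \sum_k der_map i k x * der_map k j y.
Proof.
have derE k l z : der_map k l z =
    \sum_(p <- repr (comul z)) der_rho p.2 k l *: p.1.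
  by [].
rewrite {1}/der_map comulM // (comul_sumE x) (comul_sumE y) mulr_suml.
rewrite tlift_sum; last exact: der_bil.
under [RHS]eq_bigr => k _ do rewrite !derE mulr_suml.
rewrite [RHS]exchange_big; apply: eq_bigr => a _ /=.
rewrite mulr_sumr tlift_sum; last exact: der_bil.
under [RHS]eq_bigr => k _ do rewrite mulr_sumr.
rewrite [RHS]exchange_big; apply: eq_bigr => b _ /=.
rewrite tensM tlift_tens; last exact: der_bil.
rewrite der_rhoM mxE scaler_suml; apply: eq_bigr => k _.
by rewrite -scalerAl -scalerAr scalerA.
Qed.

(* [x'] is the image of [x] under the skew derivation attached to [der_rho],
   whose twist multiplies [x] by [nu]. *)
Definition skew_der (x x' : OGLq q) (nu : K) : Prop :=
  [/\ der_map 0 0 x = x, der_map 0 1 x = x', der_map 1 0 x = 0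
    & der_map 1 1 x = nu *: x].

(** The off-diagonal entry of a product of upper triangular matrices is a twisted Leibniz rule:
    deriving the left factor costs the twist of the right one. *)
Lemma skew_derM x x' nu y y' nu' :
  skew_der x x' nu -> skew_der y y' nu' ->
  skew_der (x * y) (x * y' + nu' *: (x' * y)) (nu * nu').
Proof.
case=> xa xb xc xd [ya yb yc yd].
have o1 : lift ord0 ord0 = 1 :> 'I_2 by apply: val_inj.
split; rewrite der_mapM !big_ord_recl big_ord0 !o1 ?(xa, xb, xc, xd)
   ?(ya, yb, yc, yd) ?(mul0r, mulr0, addr0, add0r) //.
- by rewrite -scalerAr.
- by rewrite -scalerAl -scalerAr scalerA.
Qed.

Lemma skew_der1 : skew_der 1 0 1.
Proof.
have E i j : der_map i j 1 = (i == j)%:R.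
  rewrite /der_map comul1 // -tens1 tlift_tens; last exact: der_bil.
  rewrite der_rho1 mxE; case: (i == j); by rewrite ?scale1r ?scale0r.
by split; rewrite E // scale1r.
Qed.

Lemma skew_der_detinv : skew_der (detinv q) 0 1.
Proof.
have E i j : der_map i j (detinv q) = (i == j)%:R *: detinv q.
  rewrite /der_map comul_detinv // tlift_tens; last exact: der_bil.
  by rewrite der_rho_detinv mxE.
by split; rewrite E ?scale1r // scale0r.
Qed.

Lemma skew_der_glx i j :
  skew_der (glx q i j)
    (((j == j0)%:R * (1 - q ^- 2)) *: glx q i p0) (mu j).
Proof.
have E k l : der_map k l (glx q i j) =
    \sum_p der_gen (Gx p j) k l *: glx q i p.
  rewrite /der_map comul_glx // tlift_sum; last exact: der_bil.
  apply: eq_bigr => p _; rewrite tlift_tens; last exact: der_bil.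
  by rewrite der_rho_glx.
split; rewrite E /=.
- rewrite (bigD1 j) //= big1 ?addr0 ?mxE /= ?eqxx ?scale1r // => p pj.
  by rewrite mxE /= (negbTE pj) scale0r.
- rewrite (bigD1 p0) //= big1 ?addr0 ?mxE /= ?eqxx // => p pj.
  by rewrite mxE /= (negbTE pj) mul0r scale0r.
- by rewrite big1 // => p _; rewrite mxE scale0r.
- rewrite (bigD1 j) //= big1 ?addr0 ?mxE /= ?eqxx ?mul1r // => p pj.
  by rewrite mxE /= (negbTE pj) mul0r scale0r.
Qed.

(** Apply the off-diagonal coefficient of [der_rho] to (h (x) id) Delta(x) = h(x) 1. It kills 1, and
    on the left it gives h of the derivative. *)
Lemma haar_skew_der (haar : {scalar OGLq q}) x x' nu :
  is_haar_state haar -> skew_der x x' nu -> haar x' = 0.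
Proof.
case=> _ hP [_ <- _ _].
have sl : der_rho (slice_l haar (comul x)) 0 1 = 0.
  rewrite (hP x).2 -[_ *: 1]addr0 der_rho_linear.
  have r0 : der_rho 0 = 0.
    by have := der_rho_linear (-1) 0 0; rewrite scaleN1r addNr scaleN1r addNr.
  by rewrite r0 addr0 der_rho1 !mxE mulr0.
rewrite -{}sl /der_map /slice_l /tlift /fsum linear_sum.
elim: (repr _) => [|p s IHs]; rewrite ?big_nil ?big_cons.
  have := der_rho_linear (-1) 0 0; rewrite scaleN1r addNr scaleN1r addNr => ->.
  by rewrite mxE.
by rewrite der_rho_linear !mxE linearZ /= mulrC IHs.
Qed.

Lemma skew_der_exp0 x nu n : skew_der x 0 nu -> skew_der (x ^+ n) 0 (nu ^+ n).
Proof.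
move=> dx; elim: n => [|n IHn]; first by rewrite !expr0; apply: skew_der1.
rewrite !exprS; have := skew_derM dx IHn.
by rewrite mul0r mulr0 scaler0 addr0.
Qed.

(** The Leibniz rule produces the geometric sum of the q^(-2k) for k < n, which the factor 1 - q^-2
    telescopes. The new letter is put last, next to the column on the right. *)
Lemma skew_der_exp_right x x' n :
  x * x' = q *: (x' * x) -> skew_der x ((1 - q ^- 2) *: x') q^-1 ->
  skew_der (x ^+ n) ((1 - q ^- (2 * n)) *: (x ^+ n.-1 * x')) (q ^- n).
Proof.
move=> xx' dx.
have x'x k : x' * x ^+ k = q ^- k *: (x ^+ k * x').
  by rewrite (qcomm_expr k (qcommV q_neq0 xx')) exprVn.
elim: n => [|n IHn].
  rewrite muln0 !expr0 invr1 subrr scale0r; exact: skew_der1.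
have := skew_derM dx IHn; rewrite -exprS -invfM -exprS -pred_Sn.
congr (skew_der _ _ _).
rewrite -!scalerAl x'x -scalerAr scalerA scalerA.
(* At n = 0 the predecessor is truncated, but the coefficient 1 - q^0 vanishes. *)
case: n {IHn} => [|n].
  rewrite /= muln0 !expr0 invr1 subrr scale0r add0r !mul1r muln1.
  by rewrite mulr1.
rewrite /= mulrA -exprS -scalerDl; congr (_ *: _).
by rewrite !(mulnC 2%N) !exprM !exprS; field; rewrite ?expf_neq0.
Qed.

(** Here the new letter is put first, next to the column on the left; the reordering accounts for
    the power q^(n-1). *)
Lemma skew_der_exp_left x x' n :
  x' * x = q *: (x * x') -> skew_der x ((1 - q ^- 2) *: x') q ->
  skew_der (x ^+ n) ((q ^+ n.-1 * (1 - q ^- (2 * n))) *: (x' * x ^+ n.-1))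
    (q ^+ n).
Proof.
move=> x'x dx.
have xx' k : x ^+ k * x' = q ^- k *: (x' * x ^+ k).
  by rewrite (qcomm_expl k (qcommV q_neq0 x'x)) exprVn.
elim: n => [|n IHn].
  rewrite muln0 !expr0 invr1 subrr mulr0 scale0r; exact: skew_der1.
have := skew_derM IHn dx; rewrite -!exprSr -pred_Sn.
congr (skew_der _ _ _).
rewrite -scalerAr xx' -!scalerAl !scalerA.
case: n {IHn} => [|n].
  rewrite /= muln0 !expr0 invr1 subrr !mulr0 scale0r addr0 !mul1r muln1.
  by rewrite !mulr1.
rewrite /= -mulrA -exprSr -scalerDl; congr (_ *: _).
by rewrite !(mulnC 2%N) !exprM !exprS; field; rewrite ?expf_neq0.
Qed.

End Derivation.

(** * The four moves between adjacent columns and the resulting Haar relations *)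

Section ColumnMoves.
Variables (K : fieldType) (q : K).
Hypothesis q_neq0 : q != 0.

Definition twist12 (j : 'I_3) : K :=
  if j == i1 then q^-1 else if j == i2 then q else 1.
Definition twist23 (j : 'I_3) : K :=
  if j == i1 then 1 else if j == i2 then q^-1 else q.

Ltac der_compatible_tac :=
  split; [split| |]; rewrite /der_gen;
  [ elim/I3P; elim/I3P; elim/I3P=> //= _ | elim/I3P; elim/I3P; elim/I3P=> //= _
  | elim/I3P; elim/I3P; elim/I3P; elim/I3P=> //= _ _
  | elim/I3P; elim/I3P; elim/I3P; elim/I3P=> //= _ _
  | by move=> *; rewrite mul1r mulr1
  | rewrite qdetE row_qdetE mulr1 utmx1 /=];
  rewrite !utmxM ?utmxZ ?utmxD /twist12 /twist23 /=; congr utmx; field.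

(** The derivation sends entries of column [j0] to column [p0], hence [right12] moves column 1 to
    column 2 and [left12] does the reverse. The relations are checked on all index tuples. *)
Lemma der_compatible_right12 : der_compatible q twist12 i2 i1.
Proof. by der_compatible_tac. Qed.

Lemma der_compatible_left12 : der_compatible q twist12 i1 i2.
Proof. by der_compatible_tac. Qed.

Lemma der_compatible_right23 : der_compatible q twist23 i3 i2.
Proof. by der_compatible_tac. Qed.

Lemma der_compatible_left23 : der_compatible q twist23 i2 i3.
Proof. by der_compatible_tac. Qed.

Lemma glxC i (j k : 'I_3) : (j < k)%N ->
  glx q i j * glx q i k = q *: (glx q i k * glx q i j).
Proof. by move=> jk; rewrite (qm_row (glq_qm (OGLq_glq q))). Qed.

Definition row_monomial (i : 'I_3) (s u v : nat) : OGLq q :=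
  glx q i i1 ^+ s * glx q i i2 ^+ u * glx q i i3 ^+ v.

(** Only one of the three powers has a nonzero derivative, and its new letter already stands next to
    the power that it joins, so the result is again row-ordered. *)
Lemma skew_der_row_right12 i s u v :
  skew_der twist12 i2 i1 (row_monomial i s u v)
    (((1 - q ^- (2 * s)) * q ^+ u) *: row_monomial i s.-1 u.+1 v)
    (q ^- s * q ^+ u).
Proof.
have dP := der_compatible_right12.
have := skew_der_glx q_neq0 dP i i1; rewrite /= mul1r.
move=> /(skew_der_exp_right q_neq0 dP s
  (glxC i (j := i1) (k := i2) isT)) d1.
have := skew_der_glx q_neq0 dP i i2; rewrite /= mul0r scale0r.
move=> /(skew_der_exp0 q_neq0 dP u) d2.
have := skew_der_glx q_neq0 dP i i3; rewrite /= mul0r scale0r.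
move=> /(skew_der_exp0 q_neq0 dP v) d3.
have := skew_derM q_neq0 dP (skew_derM q_neq0 dP d1 d2) d3.
rewrite /twist12 /= expr1n mulr1 !mulr0 !add0r scale1r -!scalerAl scalerA.
by rewrite /row_monomial (mulrC (q ^+ u)) exprS !mulrA.
Qed.

Lemma skew_der_row_left12 i s u v :
  skew_der twist12 i1 i2 (row_monomial i s u v)
    ((q ^+ u.-1 * (1 - q ^- (2 * u))) *: row_monomial i s.+1 u.-1 v)
    (q ^- s * q ^+ u).
Proof.
have dP := der_compatible_left12.
have := skew_der_glx q_neq0 dP i i1; rewrite /= mul0r scale0r.
move=> /(skew_der_exp0 q_neq0 dP s) d1.
have := skew_der_glx q_neq0 dP i i2; rewrite /= mul1r.
move=> /(skew_der_exp_left q_neq0 dP u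
  (glxC i (j := i1) (k := i2) isT)) d2.
have := skew_der_glx q_neq0 dP i i3; rewrite /= mul0r scale0r.
move=> /(skew_der_exp0 q_neq0 dP v) d3.
have := skew_derM q_neq0 dP (skew_derM q_neq0 dP d1 d2) d3.
rewrite /twist12 /= expr1n exprVn mulr1 mul0r scaler0 addr0 mulr0 add0r scale1r.
by rewrite -!scalerAr -scalerAl /row_monomial exprSr !mulrA.
Qed.

Lemma skew_der_row_right23 i s u v :
  skew_der twist23 i3 i2 (row_monomial i s u v)
    (((1 - q ^- (2 * u)) * q ^+ v) *: row_monomial i s u.-1 v.+1)
    (q ^- u * q ^+ v).
Proof.
have dP := der_compatible_right23.
have := skew_der_glx q_neq0 dP i i1; rewrite /= mul0r scale0r.
move=> /(skew_der_exp0 q_neq0 dP s) d1.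
have := skew_der_glx q_neq0 dP i i2; rewrite /= mul1r.
move=> /(skew_der_exp_right q_neq0 dP u
  (glxC i (j := i2) (k := i3) isT)) d2.
have := skew_der_glx q_neq0 dP i i3; rewrite /= mul0r scale0r.
move=> /(skew_der_exp0 q_neq0 dP v) d3.
have := skew_derM q_neq0 dP (skew_derM q_neq0 dP d1 d2) d3.
rewrite /twist23 /= expr1n mul1r mul0r scaler0 addr0 mulr0 add0r.
rewrite -!scalerAr -scalerAl scalerA /row_monomial (mulrC (q ^+ v)).
by rewrite exprS !mulrA.
Qed.

Lemma skew_der_row_left23 i s u v :
  skew_der twist23 i2 i3 (row_monomial i s u v)
    ((q ^+ v.-1 * (1 - q ^- (2 * v))) *: row_monomial i s u.+1 v.-1)
    (q ^- u * q ^+ v).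
Proof.
have dP := der_compatible_left23.
have := skew_der_glx q_neq0 dP i i1; rewrite /= mul0r scale0r.
move=> /(skew_der_exp0 q_neq0 dP s) d1.
have := skew_der_glx q_neq0 dP i i2; rewrite /= mul0r scale0r.
move=> /(skew_der_exp0 q_neq0 dP u) d2.
have := skew_der_glx q_neq0 dP i i3; rewrite /= mul1r.
move=> /(skew_der_exp_left q_neq0 dP v
  (glxC i (j := i2) (k := i3) isT)) d3.
have := skew_derM q_neq0 dP (skew_derM q_neq0 dP d1 d2) d3.
rewrite /twist23 /= expr1n exprVn mul1r mul0r scaler0 addr0 mulr0 mul0r.
rewrite scaler0 addr0.
by rewrite -!scalerAr /row_monomial exprSr !mulrA.
Qed.

Variable haar : {scalar OGLq q}.
Hypothesis haarP : is_haar_state haar.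

(** Leibniz over the three rows: the term deriving a row carries the twists of the rows after it.
    The power of [detinv] has derivative 0 and twist 1. *)
Lemma haar_three_rows mu p0 j0 (dP : der_compatible q mu p0 j0)
    (x y z x' y' z' : OGLq q) k1 k2 k3 nu1 nu2 nu3 m :
  skew_der mu p0 j0 x (k1 *: x') nu1 -> skew_der mu p0 j0 y (k2 *: y') nu2 ->
  skew_der mu p0 j0 z (k3 *: z') nu3 ->
  nu2 * nu3 * k1 * haar (x' * y * z * detinv q ^+ m)
  + nu3 * k2 * haar (x * y' * z * detinv q ^+ m)
  + k3 * haar (x * y * z' * detinv q ^+ m) = 0.
Proof.
move=> dx dy dz.
have dm := skew_der_exp0 q_neq0 dP m (skew_der_detinv q_neq0 dP).
have dxy := skew_derM q_neq0 dP dx dy.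
have := skew_derM q_neq0 dP (skew_derM q_neq0 dP dxy dz) dm.
move/(haar_skew_der dP haarP).
rewrite expr1n scale1r mulr0 add0r -!scalerAr -!scalerAl !scalerA.
rewrite !(mulrDl, scalerDr, scalerAl) -!scalerAl !scalerA.
rewrite !linearD !linearZ /= => <-; ring.
Qed.

(* The exponents are those of the entries a, b, c / d, e, f / g, h, k. *)
Definition haar_word m s u r d n x l y t :=
  haar (row_monomial i1 s u r * row_monomial i2 d n x * row_monomial i3 l y t
        * detinv q ^+ m).

(** Each row in turn gives up one letter of column 2 to column 3. In this relation and the next
    three, a truncated predecessor of 0 always comes with a zero coefficient. *)
Lemma haar_word_right23 m s u r d n x l y t :
  q ^- n * q ^+ x * (q ^- y * q ^+ t) * ((1 - q ^- (2 * u)) * q ^+ r)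
    * haar_word m s u.-1 r.+1 d n x l y t
  + q ^- y * q ^+ t * ((1 - q ^- (2 * n)) * q ^+ x)
    * haar_word m s u r d n.-1 x.+1 l y t
  + (1 - q ^- (2 * y)) * q ^+ t * haar_word m s u r d n x l y.-1 t.+1 = 0.
Proof.
exact: (haar_three_rows der_compatible_right23 m
  (skew_der_row_right23 i1 s u r) (skew_der_row_right23 i2 d n x)
  (skew_der_row_right23 i3 l y t)).
Qed.

Lemma haar_word_left23 m s u r d n x l y t :
  q ^- n * q ^+ x * (q ^- y * q ^+ t) * (q ^+ r.-1 * (1 - q ^- (2 * r)))
    * haar_word m s u.+1 r.-1 d n x l y t
  + q ^- y * q ^+ t * (q ^+ x.-1 * (1 - q ^- (2 * x)))
    * haar_word m s u r d n.+1 x.-1 l y t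
  + q ^+ t.-1 * (1 - q ^- (2 * t)) * haar_word m s u r d n x l y.+1 t.-1 = 0.
Proof.
exact: (haar_three_rows der_compatible_left23 m
  (skew_der_row_left23 i1 s u r) (skew_der_row_left23 i2 d n x)
  (skew_der_row_left23 i3 l y t)).
Qed.

Lemma haar_word_right12 m s u r d n x l y t :
  q ^- d * q ^+ n * (q ^- l * q ^+ y) * ((1 - q ^- (2 * s)) * q ^+ u)
    * haar_word m s.-1 u.+1 r d n x l y t
  + q ^- l * q ^+ y * ((1 - q ^- (2 * d)) * q ^+ n)
    * haar_word m s u r d.-1 n.+1 x l y t
  + (1 - q ^- (2 * l)) * q ^+ y * haar_word m s u r d n x l.-1 y.+1 t = 0.
Proof.
exact: (haar_three_rows der_compatible_right12 m
  (skew_der_row_right12 i1 s u r) (skew_der_row_right12 i2 d n x)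
  (skew_der_row_right12 i3 l y t)).
Qed.

Lemma haar_word_left12 m s u r d n x l y t :
  q ^- d * q ^+ n * (q ^- l * q ^+ y) * (q ^+ u.-1 * (1 - q ^- (2 * u)))
    * haar_word m s.+1 u.-1 r d n x l y t
  + q ^- l * q ^+ y * (q ^+ n.-1 * (1 - q ^- (2 * n)))
    * haar_word m s u r d.+1 n.-1 x l y t
  + q ^+ y.-1 * (1 - q ^- (2 * y)) * haar_word m s u r d n x l.+1 y.-1 t = 0.
Proof.
exact: (haar_three_rows der_compatible_left12 m
  (skew_der_row_left12 i1 s u r) (skew_der_row_left12 i2 d n x)
  (skew_der_row_left12 i3 l y t)).
Qed.

End ColumnMoves.

(** * Gaussian binomials: index shifts and the two Pascal rules *)

Section QBinomial.
Variables (K : fieldType) (p : K).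
Hypothesis p_nroot : forall n, (0 < n)%N -> 1 - p ^+ n != 0.
Hypothesis p_neq0 : p != 0.

Lemma qpochS n : qpoch p p n.+1 = qpoch p p n * (1 - p ^+ n.+1).
Proof. by rewrite /qpoch big_ord_recr /= exprS. Qed.

Lemma qpoch0 : qpoch p p 0 = 1.
Proof. by rewrite /qpoch big_ord0. Qed.

Lemma qpoch_neq0 n : qpoch p p n != 0.
Proof.
elim: n => [|n IHn]; first by rewrite qpoch0 oner_neq0.
by rewrite qpochS mulf_neq0 ?p_nroot.
Qed.

Lemma qbinomE j k :
  qbinom p (j + k) j = qpoch p p (j + k) / (qpoch p p j * qpoch p p k).
Proof. by rewrite /qbinom leq_addr addKn. Qed.

Lemma qbinom_gt n j : (n < j)%N -> qbinom p n j = 0.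
Proof. by move=> nj; rewrite /qbinom leqNgt nj. Qed.

Lemma qbinom0 n : qbinom p n 0 = 1.
Proof. by rewrite -[n]add0n qbinomE qpoch0 mul1r divff ?qpoch_neq0. Qed.

Lemma qbinomnn n : qbinom p n n = 1.
Proof.
rewrite -[X in qbinom _ X]addn0 qbinomE qpoch0 mulr1 addn0.
by rewrite divff ?qpoch_neq0.
Qed.

Lemma qbinom_neq0 j k : qbinom p (j + k) j != 0.
Proof. by rewrite qbinomE !(mulf_neq0, invr_neq0) ?qpoch_neq0. Qed.

(** This and the next two shifts bring neighbouring binomials to a common one, which leaves rational
    identities to [field]. *)
Lemma qbinomSS n j :
  qbinom p n.+1 j.+1 = qbinom p n j * (1 - p ^+ n.+1) / (1 - p ^+ j.+1).
Proof.
have [lt_nj|/subnKC <-] := ltnP n j.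
  by rewrite !qbinom_gt // !mul0r.
rewrite -addSn !qbinomE addSn !qpochS; field.
by rewrite !qpoch_neq0 !p_nroot.
Qed.

Lemma qbinom_upS j k :
  qbinom p (j + k).+1 j = qbinom p (j + k) j * (1 - p ^+ (j + k).+1)
    / (1 - p ^+ k.+1).
Proof.
rewrite -addnS !qbinomE addnS !qpochS; field.
by rewrite !qpoch_neq0 !p_nroot.
Qed.

Lemma qbinom_downS n j :
  qbinom p n j.+1 = qbinom p n j * (1 - p ^+ n / p ^+ j) / (1 - p ^+ j.+1).
Proof.
have [lt_nj|/subnKC <-] := ltnP n j.
  by rewrite !qbinom_gt // ?mul0r // ltnS ltnW.
(* At j = n the binomial on the left is 0 by convention, and the factor 1 - p^n / p^j vanishes
   too. *)
case: (n - j)%N => [|k].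
  by rewrite addn0 qbinom_gt // divff ?expf_neq0 // subrr mulr0 mul0r.
rewrite -addSnnS qbinomE addSnnS qbinomE addnS !qpochS -addnS exprD.
by field; rewrite !qpoch_neq0 !p_nroot // !expf_neq0.
Qed.

Lemma qbinom_pascal n j :
  qbinom p n.+1 j.+1 = p ^+ j.+1 * qbinom p n j.+1 + qbinom p n j.
Proof.
rewrite qbinomSS qbinom_downS !exprS; field.
by rewrite expf_neq0 // -exprS p_nroot.
Qed.

Lemma qbinom_pascal' n j :
  qbinom p n.+1 j.+1 = qbinom p n j.+1 + p ^+ n / p ^+ j * qbinom p n j.
Proof.
rewrite qbinomSS qbinom_downS !exprS; field.
by rewrite expf_neq0 // -exprS p_nroot.
Qed.

End QBinomial.

(** * The alternating sum of the theorem and its contiguous relation *)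

Section QSum.
Variables (K : fieldType) (q : K).
Hypothesis q_neq0 : q != 0.
Hypothesis q_nroot : forall n, (0 < n)%N -> 1 - (q ^+ 2) ^+ n != 0.
Local Notation p := (q ^+ 2).
Local Notation C := (qbinom p).

Let p_neq0 : p != 0. Proof. exact: expf_neq0. Qed.

Definition qsum (s r l t n : nat) : K :=
  \sum_(0 <= j < n.+1)
    (-1) ^+ j *
    q ^ ((n%:Z - j%:Z) * (n%:Z - 3 * j%:Z - 1)
         + 2 * j%:Z * (s%:Z + t%:Z)) *
    (C r j * C l j * C s (n - j) * C t (n - j) / C n j).

Lemma qsum0 s r l t : qsum s r l t 0 = 1.
Proof.
by rewrite /qsum big_nat1 !qbinom0 // expr0 divr1 !mulr1.
Qed.

Lemma qsumC s r l t n : qsum s r l t n = qsum t l r s n.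
Proof.
rewrite /qsum; apply: eq_bigr => j _.
by rewrite (addrC s%:Z); congr (_ * (_ / _)); ring.
Qed.

Lemma expr_sqr_exprz (a : nat) : p ^+ a = q ^ (2 * a%:Z).
Proof. by rewrite -exprM exprnP PoszM. Qed.

(* By the two q-Pascal rules the difference of the terms of index [j] is
   [f j - g j], where [f j] and [g j.+1] have the same factors [C r j] and
   [C t (n - j)] as the term of index [j] on the right. *)
Lemma qsum_contiguous s r l t n :
  (1 - p ^+ n.+1) * (qsum s r l t.+1 n.+1 - qsum s r.+1 l t n.+1) =
  (1 - p ^+ s * p ^+ l / p ^+ n) * p ^+ t * qsum s r l t n.
Proof.
pose b j := (-1) ^+ j *
  q ^ ((n.+1%:Z - j%:Z) * (n.+1%:Z - 3 * j%:Z - 1)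
         + 2 * j%:Z * (s%:Z + t%:Z)) * (C l j * C s (n.+1 - j) / C n.+1 j).
pose f j := b j * p ^+ j * (C r j * (C t.+1 (n.+1 - j) - C t (n.+1 - j))).
pose g j := b j * (C t (n.+1 - j) * (C r.+1 j - p ^+ j * C r j)).
have -> : qsum s r l t.+1 n.+1 - qsum s r.+1 l t n.+1 =
    \sum_(0 <= j < n.+2) f j - \sum_(0 <= j < n.+2) g j.
  rewrite -!sumrB; apply: eq_bigr => j _; rewrite /f /g /b.
  have -> : q ^ ((n.+1%:Z - j%:Z) * (n.+1%:Z - 3 * j%:Z - 1)
         + 2 * j%:Z * (s%:Z + t.+1%:Z)) =
     q ^ ((n.+1%:Z - j%:Z) * (n.+1%:Z - 3 * j%:Z - 1)
         + 2 * j%:Z * (s%:Z + t%:Z)) * p ^+ j.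
    by rewrite expr_sqr_exprz -expfzDr //; congr (_ ^ _); rewrite (intS t); ring.
  by ring.
rewrite (big_nat_recr n.+1) // [\sum_(0 <= j < n.+2) g j]big_nat_recl //=.
(* The boundary terms vanish, so [f j] can be paired with [g j.+1]. *)
have -> : f n.+1 = 0 by rewrite /f subnn !qbinom0 // subrr !mulr0.
have -> : g 0%N = 0 by rewrite /g !qbinom0 // expr0 mulr1 subrr !mulr0.
rewrite addr0 add0r -sumrB /qsum !mulr_sumr.
apply: eq_big_nat => j /andP[_]; rewrite ltnS => /subnKC.
move: (n - j)%N => k jk.
have e1 : ((j + k).+1 - j = k.+1)%N by lia.
rewrite /f /g /b -jk subSS addKn e1.
rewrite (qbinom_pascal q_nroot p_neq0 r) (qbinom_pascal' q_nroot p_neq0 t).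
rewrite (qbinomSS q_nroot (j + k) j) (qbinom_upS q_nroot).
rewrite (qbinom_downS q_nroot p_neq0 l) (qbinom_downS q_nroot p_neq0 s k).
(* The exponent in the right-hand term of index j = n - k; the exponents in [f j] and [g j.+1] are
   measured against it. *)
pose e := k%:Z * (k%:Z - 2 * j%:Z - 1) + 2 * j%:Z * (s%:Z + t%:Z).
have /= -> : q ^ (((j + k).+1%:Z - j%:Z) * ((j + k).+1%:Z - 3 * j%:Z - 1)
    + 2 * j%:Z * (s%:Z + t%:Z)) = q ^ e * p ^+ k / p ^+ j.
  rewrite !expr_sqr_exprz invr_expz -!expfzDr //; congr (_ ^ _).
  by rewrite /e intS PoszD; ring.
have /= -> : q ^ (((j + k).+1%:Z - j.+1%:Z) *
    ((j + k).+1%:Z - 3 * j.+1%:Z - 1) + 2 * j.+1%:Z * (s%:Z + t%:Z))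
    = q ^ e * p ^+ s * p ^+ t / p ^+ k.
  rewrite !expr_sqr_exprz invr_expz -!expfzDr //; congr (_ ^ _).
  by rewrite /e !intS PoszD; ring.
have /= -> : q ^ (((j + k)%:Z - j%:Z) * ((j + k)%:Z - 3 * j%:Z - 1)
    + 2 * j%:Z * (s%:Z + t%:Z)) = q ^ e.
  by congr (_ ^ _); rewrite /e PoszD; ring.
move: (q ^ e) => B.
have [P0 Pn] := (p_neq0, q_nroot); move: (q ^+ 2) P0 Pn => P P0 Pn.
rewrite !exprS !exprD; field.
by rewrite qbinom_neq0 // !expf_neq0 // -!exprS -?exprD -?exprS !Pn.
Qed.
End QSum.

(** * The predicted ratios satisfy the relations of the Haar state *)

Section ClosedForm.
Variables (K : fieldType) (q : K).
Hypothesis q_neq0 : q != 0.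
Hypothesis q_nroot : forall n, (0 < n)%N -> 1 - (q ^+ 2) ^+ n != 0.
Local Notation p := (q ^+ 2).
Local Notation C := (qbinom p).
Local Notation "n `_q!" := (qpoch p p n) (at level 2, format "n `_q!").
Local Notation qexp m s r l t n :=
  ((2 * m%:Z + 1) * (l%:Z + r%:Z) + (n%:Z - 2) * m%:Z
   - 2 * l%:Z ^+ 2 - 2 * r%:Z ^+ 2 - r%:Z * l%:Z
   + 4 * s%:Z * t%:Z - 3 * n%:Z * s%:Z - 3 * n%:Z * t%:Z).

Let p_neq0 : p != 0. Proof. exact: expf_neq0. Qed.
Let pf_neq0 n : n`_q! != 0. Proof. exact: qpoch_neq0. Qed.

Let p2 k : p ^+ k = q ^+ k * q ^+ k.
Proof. by rewrite -exprM mulnC exprM expr2. Qed.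
Let q2 k : q ^+ (2 * k) = q ^+ k * q ^+ k.
Proof. by rewrite exprM p2. Qed.

(** The predicted quotient of [haar_word] by h(c^m e^m g^m det^-m), with the nine exponents in the
    same order. *)
Definition haar_ratio (m s u r d n x l y t : nat) : K :=
  qsum q s r l t n *
  ((-1) ^+ (r + l + n) * q ^ qexp m s r l t n /
   (qmultinom p m n d x * qmultinom p m n u y)).

Lemma haar_ratioE m s u r d n x l y t :
  haar_ratio m s u r d n x l y t =
  (-1) ^+ (r + l + n) * q ^ qexp m s r l t n * qsum q s r l t n *
  (n`_q! ^+ 2 * d`_q! * x`_q! * u`_q! * y`_q!) / m`_q! ^+ 2.
Proof. by rewrite /haar_ratio /qmultinom; field; rewrite !pf_neq0. Qed.

(* The rotation of the matrix of exponents by a half turn. *)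
Lemma haar_ratioC m s u r d n x l y t :
  haar_ratio m s u r d n x l y t = haar_ratio m t y l x n d r u s.
Proof.
rewrite !haar_ratioE (qsumC q s) (addnC r).
have -> : qexp m s r l t n = qexp m t l r s n by ring.
by field; rewrite pf_neq0.
Qed.

(** For every j either j > l or n - j > t, so a binomial vanishes in each term. *)
Lemma qsum_gt s r l t n : (l + t < n)%N -> qsum q s r l t n = 0.
Proof.
move=> ltn; apply: big1_seq => j; rewrite mem_index_iota => /andP[_ /andP[_ jn]].
have [lj|jl] := ltnP l j; first by rewrite (qbinom_gt _ lj) !(mulr0, mul0r).
by rewrite (@qbinom_gt _ _ t) ?(mulr0, mul0r) //; lia.
Qed.

(** Once the common powers and factorials are removed, this is [qsum_contiguous] at n - 1. *)
Lemma haar_ratio_right23 m s u r d n x l y t :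
  (s + u + r = m)%N -> (d + n + x = m)%N -> (l + y.+1 + t = m)%N ->
  (s + d + l = m)%N -> (u + n + y = m)%N ->
  q ^- n * q ^+ x * (q ^- y.+1 * q ^+ t) * ((1 - q ^- (2 * u)) * q ^+ r)
    * haar_ratio m s u.-1 r.+1 d n x l y.+1 t
  + q ^- y.+1 * q ^+ t * ((1 - q ^- (2 * n)) * q ^+ x)
    * haar_ratio m s u r d n.-1 x.+1 l y.+1 t
  + (1 - q ^- (2 * y.+1)) * q ^+ t * haar_ratio m s u r d n x l y t.+1 = 0.
Proof.
move=> e1 e2 e3 e4 e5; rewrite !haar_ratioE.
(* The balance of rows and columns expresses all exponents through s, r, l, t, n; the powers of q
   can then be compared with the one of the third word. *)
have Eu : u%:Z = l%:Z + t%:Z + 1 - n%:Z by lia.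
have Ex : x%:Z = s%:Z + l%:Z - n%:Z by lia.
have Ey : y.+1%:Z = s%:Z + r%:Z + 1 - n%:Z by lia.
have Em : m%:Z = s%:Z + r%:Z + l%:Z + t%:Z + 1 - n%:Z by lia.
pose Z := q ^ qexp m s r l t.+1 n.
have -> : q ^ qexp m s r.+1 l t n =
    Z * q ^+ n * p ^+ u / (q ^+ x * q ^+ y.+1 * q ^+ r).
  rewrite !expr_sqr_exprz !exprnP !invfM !invr_expz -!expfzDr //; congr (_ ^ _).
  by rewrite Eu Ex Ey Em (intS r) (intS t); ring.
rewrite -/Z.
(* At u = 0 the factorial step fails, but balance then forces n = l + t + 1 and the sum is 0. *)
have U1 : (1 - p ^+ u) * u.-1`_q! * qsum q s r.+1 l t n =
    u`_q! * qsum q s r.+1 l t n.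
  case: (u) Eu => [|u'] Eu; last by rewrite qpochS; ring.
  by rewrite qsum_gt ?mulr0 //; lia.
have -> : (1 - q ^- (2 * u)) = - (1 - p ^+ u) / p ^+ u.
  by rewrite exprM; field; rewrite expf_neq0.
set S3 := qsum q s r l t.+1 n; set S1 := qsum q s r.+1 l t n in U1 *.
set S2 := qsum q s r l t n.-1.
have Y2 : p ^+ y.+1 = q ^+ y.+1 * q ^+ y.+1 by rewrite -exprM mulnC exprM expr2.
rewrite (exprM q 2 y.+1) (qpochS _ y) Y2.
pose G := (-1) ^+ (r + l + n) * Z * q ^+ t / (q ^+ y.+1 * q ^+ y.+1)
  / m`_q! ^+ 2 * (d`_q! * x`_q! * y`_q!) * (1 - q ^+ y.+1 * q ^+ y.+1).
have -> : q ^- n * q ^+ x * (q ^- y.+1 * q ^+ t) *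
    (- (1 - p ^+ u) / p ^+ u * q ^+ r) *
    ((-1) ^+ (r.+1 + l + n) *
     (Z * q ^+ n * p ^+ u / (q ^+ x * q ^+ y.+1 * q ^+ r)) * S1 *
     (n`_q! ^+ 2 * d`_q! * x`_q! * u.-1`_q! *
       (y`_q! * (1 - q ^+ y.+1 * q ^+ y.+1))) / m`_q! ^+ 2) =
    G * n`_q! ^+ 2 * ((1 - p ^+ u) * u.-1`_q! * S1).
  have -> : (-1) ^+ (r.+1 + l + n) = - (-1) ^+ (r + l + n) :> K.
    by rewrite !addSn exprS mulN1r.
  rewrite /G; field.
  by rewrite !expf_neq0 ?pf_neq0.
(* At n = 0 the middle coefficient vanishes and both remaining sums are 1. *)
rewrite U1; have [n0|n_gt0] := posnP n.
  rewrite n0 muln0 expr0 invr1 subrr mul0r mulr0 mul0r addr0.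
  rewrite /S1 /S3 n0 !qsum0 // /G n0; field.
  by rewrite expf_neq0 ?pf_neq0.
have [k nk] : exists k, n = k.+1 by case: (n) n_gt0 => // k; exists k.
have -> : q ^ qexp m s r l t n.-1 = Z * p ^+ t * p ^+ n / (q ^+ y.+1 * q ^+ x).
  rewrite !expr_sqr_exprz !exprnP !invfM !invr_expz -!expfzDr //; congr (_ ^ _).
  by rewrite Ex Ey Em nk (intS k) (intS t); ring.
have St := qsum_contiguous q_neq0 q_nroot s r l t k.
(* With n = k + 1, balance gives x + 1 = s + l - k: the factor in the contiguous relation is the one
   relating the factorials of x + 1 and x. *)
have Sx : 1 - p ^+ x.+1 = 1 - p ^+ s * p ^+ l / p ^+ k.
  congr (1 - _); apply: (mulIf (expf_neq0 k p_neq0)).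
  by rewrite mulfVK ?expf_neq0 // -!exprD; congr (_ ^+ _); lia.
rewrite -Sx -nk in St; rewrite (qpochS _ x).
have -> : (1 - q ^- (2 * n)) = - (1 - p ^+ n) / p ^+ n.
  by rewrite exprM; field; rewrite expf_neq0.
have nq : n`_q! = n.-1`_q! * (1 - p ^+ n) by rewrite nk qpochS.
have Sk : S2 = qsum q s r l t k by rewrite /S2 nk.
transitivity (- G * u`_q! * n.-1`_q! ^+ 2 * (1 - p ^+ n) *
  ((1 - p ^+ n) * (S3 - S1) - (1 - p ^+ x.+1) * p ^+ t * S2)); last first.
  by rewrite Sk St subrr mulr0.
have -> : (-1) ^+ (r + l + n.-1) = - (-1) ^+ (r + l + n) :> K.
  by rewrite nk /= addnS exprS; ring.
rewrite /G nq.
field.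
by rewrite !expf_neq0 ?pf_neq0.
Qed.

(** A half turn carries this relation to [haar_ratio_right23], up to the nonzero scalar [c] of the
    proof. *)
Lemma haar_ratio_left12 m s u r d n x l y t :
  (s + u.+1 + r = m)%N -> (d + n + x = m)%N -> (l + y + t = m)%N ->
  (u + n + y = m)%N -> (r + x + t = m)%N ->
  q ^- d * q ^+ n * (q ^- l * q ^+ y) * (q ^+ u * (1 - q ^- (2 * u.+1)))
    * haar_ratio m s.+1 u r d n x l y t
  + q ^- l * q ^+ y * (q ^+ n.-1 * (1 - q ^- (2 * n)))
    * haar_ratio m s u.+1 r d.+1 n.-1 x l y t
  + q ^+ y.-1 * (1 - q ^- (2 * y)) * haar_ratio m s u.+1 r d n x l.+1 y.-1 t = 0.
Proof.
move=> e1 e2 e3 e4 e5.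
have h1 : (t + y + l = m)%N by lia.
have h2 : (x + n + d = m)%N by lia.
have h3 : (r + u.+1 + s = m)%N by lia.
have h4 : (t + x + r = m)%N by lia.
have h5 : (y + n + u = m)%N by lia.
have H := haar_ratio_right23 h1 h2 h3 h4 h5.
pose c := q ^- d * q ^+ n * (q ^- l * q ^+ y) * q ^+ u * q ^- s.
rewrite (haar_ratioC m s.+1) !(haar_ratioC m s) -[RHS](mulr0 c) -{}H /c.
(* The bracket vanishes at k = 0 and so hides the truncation of k - 1. *)
have hp k : q ^+ k.-1 * (1 - q ^- (2 * k)) = q ^+ k / q * (1 - q ^- (2 * k)).
  case: k => [|k]; first by rewrite muln0 expr0 invr1 subrr !mulr0.
  by rewrite /= exprS [q * _]mulrC mulfK.
rewrite !hp [q ^+ u.+1]exprS; move: (_ ^- (2 * y)) (_ ^- (2 * n)) => Y N.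
move: (_ ^- (2 * _)) => U; field.
by rewrite !expf_neq0 // q_neq0.
Qed.

(** Only j = n survives, since the binomials of 0 over n - j vanish for j < n. *)
Lemma qsum_st0 r l n : qsum q 0 r l 0 n = (-1) ^+ n * (C r n * C l n).
Proof.
rewrite /qsum big_nat_recr //= big1_seq ?add0r; last first.
  move=> j; rewrite mem_index_iota => /andP[_ /andP[_ jn]].
  by rewrite (@qbinom_gt _ _ 0) ?(mulr0, mul0r) // subn_gt0.
rewrite subnn subrr mul0r add0r mulr0 expr0z mulr1.
by rewrite !qbinom0 // qbinomnn // divr1 !mulr1.
Qed.

(** Without a and k, balance leaves the parameters n, u, d, and the ratio is a plain product on
    which two-term recurrences can be checked directly. *)
Lemma haar_ratio_st0 m u d n : (n + u + d = m)%N ->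
  haar_ratio m 0 u (n + d) d n u (n + u) d 0 =
  (-1) ^+ (u + d) * q ^ (2 * m%:Z * (u%:Z + d%:Z) - u%:Z - d%:Z
     - 2 * u%:Z ^+ 2 - 2 * d%:Z ^+ 2 - u%:Z * d%:Z) *
   ((n + d)`_q! * (n + u)`_q! * d`_q! * u`_q!) / m`_q! ^+ 2.
Proof.
move=> <-; rewrite haar_ratioE qsum_st0 !qbinomE.
have -> : qexp (n + u + d) 0 (n + d) (n + u) 0 n = 
   2 * (n + u + d)%:Z * (u%:Z + d%:Z) - u%:Z - d%:Z
     - 2 * u%:Z ^+ 2 - 2 * d%:Z ^+ 2 - u%:Z * d%:Z.
  by rewrite !PoszD; ring.
have sg : (-1) ^+ (n + d + (n + u) + n) * (-1) ^+ n = (-1) ^+ (u + d) :> K.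
  rewrite -exprD -signr_odd -[in RHS]signr_odd; congr (_ ^+ _).
  by rewrite !oddD; do 3!case: odd.
by rewrite -sg; field; rewrite !pf_neq0.
Qed.

Lemma haar_ratio_left23_st0 m u d n : (n + u.+1 + d = m)%N ->
  q ^- n * q ^+ u.+1 * q ^- d * (q ^+ (n + d) * (1 - q ^- (2 * (n + d).+1)))
    * haar_ratio m 0 u.+1 (n + d) d n u.+1 (n + u.+1) d 0
  + q ^- d * (q ^+ u * (1 - q ^- (2 * u.+1)))
    * haar_ratio m 0 u (n + d).+1 d n.+1 u (n + u.+1) d 0 = 0.
Proof.
move=> e; have e' : (n.+1 + u + d = m)%N by rewrite addSnnS.
have T2 := haar_ratio_st0 e'; rewrite [X in haar_ratio m 0 u X]addSn addSnnS in T2.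
rewrite (haar_ratio_st0 e) T2.
set Z := q ^ (2 * m%:Z * (u%:Z + d%:Z) - u%:Z - d%:Z
     - 2 * u%:Z ^+ 2 - 2 * d%:Z ^+ 2 - u%:Z * d%:Z).
have -> : q ^ (2 * m%:Z * (u.+1%:Z + d%:Z) - u.+1%:Z - d%:Z
     - 2 * u.+1%:Z ^+ 2 - 2 * d%:Z ^+ 2 - u.+1%:Z * d%:Z) =
    Z * q ^+ n * q ^+ n * q ^+ d / (q ^+ u * q ^+ u * q ^+ 1).
  rewrite !exprnP !invfM !invr_expz -!expfzDr //; congr (_ ^ _).
  by rewrite -e !PoszD (intS u); ring.
have := pf_neq0 m; move: (m`_q!) => M M0.
rewrite !addSn !addnS !qpochS !p2 !q2 !exprS !exprD expr0; field.
by rewrite M0 q_neq0 !expf_neq0.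
Qed.

Lemma haar_ratio_right12_st0 m u d n : (n + u + d.+1 = m)%N ->
  q ^- (n + u).+1 * q ^+ d * ((1 - q ^- (2 * d.+1)) * q ^+ n)
    * haar_ratio m 0 u (n + d.+1) d n.+1 u (n + u).+1 d 0
  + (1 - q ^- (2 * (n + u).+1)) * q ^+ d
    * haar_ratio m 0 u (n + d.+1) d.+1 n u (n + u) d.+1 0 = 0.
Proof.
move=> e; have e' : (n.+1 + u + d = m)%N by rewrite -e addnS.
have T2 := haar_ratio_st0 e'; rewrite [(n.+1 + d)%N]addSnnS [(n.+1 + u)%N]addSn in T2.
rewrite (haar_ratio_st0 e) T2.
set Z := q ^ (2 * m%:Z * (u%:Z + d%:Z) - u%:Z - d%:Z
     - 2 * u%:Z ^+ 2 - 2 * d%:Z ^+ 2 - u%:Z * d%:Z).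
have -> : q ^ (2 * m%:Z * (u%:Z + d.+1%:Z) - u%:Z - d.+1%:Z
     - 2 * u%:Z ^+ 2 - 2 * d.+1%:Z ^+ 2 - u%:Z * d.+1%:Z) =
    Z * q ^+ n * q ^+ n * q ^+ u / (q ^+ d * q ^+ d * q ^+ 1).
  rewrite !exprnP !invfM !invr_expz -!expfzDr //; congr (_ ^ _).
  by rewrite -e !PoszD (intS d); ring.
have := pf_neq0 m; move: (m`_q!) => M M0.
rewrite !addnS !qpochS !p2 !q2 !exprS !exprD expr0; field.
by rewrite M0 q_neq0 !expf_neq0.
Qed.

(** * The relations determine every Haar value of balanced degree *)

Section Uniqueness.
Variable haar : {scalar OGLq q}.
Hypothesis haarP : is_haar_state haar.
Local Notation word := (haar_word haar).
Local Notation H m := (word m 0 0 m 0 m 0 m 0 0).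

Lemma haar_ratio_diag m : haar_ratio m 0 0 m 0 m 0 m 0 0 = 1.
Proof.
have := @haar_ratio_st0 m 0 0 m; rewrite !addn0 => -> //.
rewrite qpoch0 !mulr1 expr0 mul1r -mulrA -expr2 divff ?mulf_neq0 ?pf_neq0 //.
by rewrite mulr1 [X in q ^ X](_ : _ = 0) //; ring.
Qed.

Lemma eliminate2 (a b v1 v2 t1 t2 h : K) : a != 0 ->
  a * v1 + b * v2 = 0 -> a * t1 + b * t2 = 0 -> v2 = t2 * h -> v1 = t1 * h.
Proof.
move=> a0 /eqP; rewrite addr_eq0 => /eqP ev /eqP; rewrite addr_eq0 => /eqP et v2E.
by apply: (mulfI a0); rewrite ev v2E [RHS]mulrA et; ring.
Qed.

(** The known values are compared after multiplication by their coefficients, so that a neighbour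
    outside the range, whose coefficient is 0, needs no value. *)
Lemma eliminate3 (a b c v1 v2 v3 t1 t2 t3 h : K) : c != 0 ->
  a * v1 + b * v2 + c * v3 = 0 -> a * t1 + b * t2 + c * t3 = 0 ->
  a * v1 = a * (t1 * h) -> b * v2 = b * (t2 * h) -> v3 = t3 * h.
Proof.
move=> c0; rewrite addrC => ev; rewrite addrC => et e1 e2.
apply: (@eliminate2 c 1 v3 (a * v1 + b * v2) t3 (a * t1 + b * t2)) => //.
- by rewrite mul1r.
- by rewrite mul1r.
- by rewrite e1 e2 mulrDl !mulrA.
Qed.

Lemma bracket_neq0 k : 1 - q ^- (2 * k.+1) != 0.
Proof.
rewrite exprM -oppr_eq0 opprB -[1 in X in _ + X](mulfV (expf_neq0 k.+1 p_neq0)).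
rewrite -[X in X - _]mul1r -mulrBl mulf_neq0 ?invr_neq0 ?expf_neq0 //.
exact: q_nroot.
Qed.

(* With no [a] and no [k] two of the relations reduce to two terms. *)
Lemma haar_word_st0 m u d n : (n + u + d = m)%N ->
  word m 0 u (n + d) d n u (n + u) d 0 =
  haar_ratio m 0 u (n + d) d n u (n + u) d 0 * H m.
Proof.
(* Each step lowers d, or u once d = 0, and raises n by one; the chain ends at c^m e^m g^m. *)
elim: d n => [|d IHd] n e; first elim: u n e => [|u IHu] n e.
- by rewrite !addn0 in e *; rewrite e haar_ratio_diag mul1r.
- have := haar_ratio_left23_st0 e.
  have := haar_word_left23 q_neq0 haarP m 0 u (n + 0).+1 0 n u.+1 (n + u.+1) 0 0.
  rewrite muln0 !expr0 !invr1 subrr !mulr0 mul0r addr0 !mulr1 !mul1r /= => ev et.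
  apply: eliminate2 ev et _.
    by rewrite !mulf_neq0 ?bracket_neq0 ?invr_eq0 ?expf_neq0.
  have := IHu n.+1; rewrite !addn0 in e *; rewrite -addSnnS; apply.
  by rewrite -e addSnnS.
have := haar_ratio_right12_st0 e.
have := haar_word_right12 q_neq0 haarP m 0 u (n + d.+1) d.+1 n u (n + u).+1 d 0.
rewrite muln0 !expr0 !invr1 subrr mul0r mulr0 mul0r add0r /= addrC => ev.
rewrite addrC => et; apply: eliminate2 ev et _.
  by rewrite !mulf_neq0 ?bracket_neq0 ?invr_eq0 ?expf_neq0.
have := IHd n.+1; rewrite -addSnnS [(n.+1 + u)%N]addSn; apply.
by rewrite -e addnS.
Qed.

(** Induction on s: the [left12] relation expresses a word with s + 1 letters a through two words
    with s of them. *)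
Lemma haar_word_t0 m s u r d n x l y :
  (s + u + r = m)%N -> (d + n + x = m)%N -> (l + y = m)%N ->
  (s + d + l = m)%N -> (u + n + y = m)%N -> (r + x = m)%N ->
  word m s u r d n x l y 0 = haar_ratio m s u r d n x l y 0 * H m.
Proof.
elim: s u r d n x l y => [|s IHs] u r d n x l y e1 e2 e3 e4 e5 e6.
  have -> : x = u by lia.
  have -> : y = d by lia.
  have -> : r = (n + d)%N by lia.
  have -> : l = (n + u)%N by lia.
  by apply: haar_word_st0; lia.
have := @haar_ratio_left12 m s u r d n x l y 0.
have := haar_word_left12 q_neq0 haarP m s u.+1 r d n x l y 0.
rewrite -addrA addrC => ev et.
have {et} : q ^- l * q ^+ y * (q ^+ n.-1 * (1 - q ^- (2 * n)))
    * haar_ratio m s u.+1 r d.+1 n.-1 x l y 0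
  + q ^+ y.-1 * (1 - q ^- (2 * y)) * haar_ratio m s u.+1 r d n x l.+1 y.-1 0
  + q ^- d * q ^+ n * (q ^- l * q ^+ y) * (q ^+ u * (1 - q ^- (2 * u.+1)))
    * haar_ratio m s.+1 u r d n x l y 0 = 0.
  by rewrite addrC addrA; apply: et; lia.
move=> et; apply: eliminate3 ev et _ _.
- by rewrite !mulf_neq0 ?bracket_neq0 ?invr_eq0 ?expf_neq0.
- case: n e2 e5 => [|n] e2 e5; first
    by rewrite muln0 expr0 invr1 subrr !mulr0 !mul0r.
  by rewrite IHs //=; lia.
- case: y e3 e5 => [|y] e3 e5; first
    by rewrite muln0 expr0 invr1 subrr !mulr0 !mul0r.
  by rewrite IHs //=; lia.
Qed.

(** Induction on t in the same way, by the [right23] relation on the letters k. *)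
Lemma haar_wordE m s u r d n x l y t :
  (s + u + r = m)%N -> (d + n + x = m)%N -> (l + y + t = m)%N ->
  (s + d + l = m)%N -> (u + n + y = m)%N -> (r + x + t = m)%N ->
  word m s u r d n x l y t = haar_ratio m s u r d n x l y t * H m.
Proof.
elim: t u r d n x l y => [|t IHt] u r d n x l y e1 e2 e3 e4 e5 e6.
  by apply: haar_word_t0; lia.
have := haar_word_right23 q_neq0 haarP m s u r d n x l y.+1 t.
have e3' : (l + y.+1 + t = m)%N by lia.
have et := haar_ratio_right23 e1 e2 e3' e4 e5.
move=> ev; apply: eliminate3 ev et _ _.
- by rewrite !mulf_neq0 ?bracket_neq0 ?expf_neq0.
- case: u e1 e5 => [|u] e1 e5.
    by rewrite muln0 expr0 invr1 subrr !(mulr0, mul0r).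
  by rewrite IHt //=; lia.
- case: n e2 e5 => [|n] e2 e5.
    by rewrite muln0 expr0 invr1 subrr !(mulr0, mul0r).
  by rewrite IHt //=; lia.
Qed.

End Uniqueness.

End ClosedForm.

(** * The value of h(c^m e^m g^m det^-m) *)

Section Normalisation.
Variables (K : fieldType) (q : K).
Hypothesis q_neq0 : q != 0.
Hypothesis q_nroot : forall n, (0 < n)%N -> 1 - (q ^+ 2) ^+ n != 0.
Local Notation p := (q ^+ 2).
Local Notation C := (qbinom p).
Local Notation "n `_q!" := (qpoch p p n) (at level 2, format "n `_q!").
Variable haar : {scalar OGLq q}.
Hypothesis haarP : is_haar_state haar.
Local Notation word := (haar_word haar).
Local Notation x := (glx q).
Local Notation xc := (x i1 i3).
Local Notation xd := (x i2 i1).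
Local Notation xh := (x i3 i2).

Let xq : is_qmatrix q x := glq_qm (OGLq_glq q).

(** A term of the determinant is put in row order: its first letter passes c^m and d^m, its last one
    is absorbed with h^m, and the middle one stays behind d^m. *)
Lemma monomial_insert m (y1 y2 y3 z3 : OGLq q) (k1 k2 k3 : K) :
  xc ^+ m * y1 = k1 *: (y1 * xc ^+ m) ->
  xd ^+ m * y1 = k2 *: (y1 * xd ^+ m) ->
  y3 * xh ^+ m = k3 *: z3 ->
  xc ^+ m * xd ^+ m * (y1 * y2 * y3) * xh ^+ m =
  (k1 * k2 * k3) *: (y1 * xc ^+ m * (xd ^+ m * y2) * z3).
Proof.
move=> h1 h2 h3.
rewrite -!mulrA h3 (mulrA (xd ^+ m) y1) h2 -scalerAl -!mulrA -!scalerAr.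
rewrite (mulrA (xc ^+ m) y1) h1 -!scalerAl !scalerA !mulrA; congr (_ *: _); ring.
Qed.

Lemma haar_insert_qdet m :
  word m 0 0 m m 0 0 0 m 0 =
  haar (xc ^+ m * xd ^+ m * qdet q x * xh ^+ m * detinv q ^+ m.+1).
Proof.
have [_ dC dI] := OGLq_glq q.
have dX n i j : detinv q * x i j ^+ n = x i j ^+ n * detinv q.
  by apply: commrX; apply: dC.
rewrite exprS -[X in _ = haar X]mulrA (mulrA (xh ^+ m)) -dX !mulrA.
rewrite -(mulrA (xc ^+ m * xd ^+ m)) dI mulr1.
by rewrite /haar_word /row_monomial !expr0 !(mulr1, mul1r).
Qed.

Lemma haar_word_qdet m : word m 0 0 m m 0 0 0 m 0 =
  q ^- (3 * m) * word m.+1 1 0 m m 1 0 0 m 1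
  - q * q ^- (2 * m) * word m.+1 0 1 m m.+1 0 0 0 m 1
  - q * q ^- (2 * m) * word m.+1 1 0 m m 0 1 0 m.+1 0
  + q ^+ 2 * q ^- m * word m.+1 0 1 m m 0 1 1 m 0
  + q ^+ 2 * word m.+1 0 0 m.+1 m.+1 0 0 0 m.+1 0
  - q ^+ 3 * word m.+1 0 0 m.+1 m 1 0 1 m 0.
Proof.
rewrite haar_insert_qdet qdetE row_qdetE.
have [xcol xrow xcomm _] := xq.
(* The letters a, b, c pass c^m and d^m, and k passes h^m, using only row, column and commuting
   relations. *)
have ca := qcomm_expl m (qcommV q_neq0 (xrow i1 i1 i3 isT)).
have cb := qcomm_expl m (qcommV q_neq0 (xrow i1 i2 i3 isT)).
have cc : xc ^+ m * xc = 1 *: (xc * xc ^+ m) by rewrite scale1r -exprS exprSr.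
have da := qcomm_expl m (qcommV q_neq0 (xcol i1 i2 i1 isT)).
have db : xd ^+ m * x i1 i2 = 1 *: (x i1 i2 * xd ^+ m).
  by rewrite scale1r; apply/commr_sym/commrX; apply: xcomm.
have dc : xd ^+ m * xc = 1 *: (xc * xd ^+ m).
  by rewrite scale1r; apply/commr_sym/commrX; apply: xcomm.
have kh := qcomm_expr m (qcommV q_neq0 (xrow i3 i2 i3 isT)).
have hh : xh * xh ^+ m = 1 *: (xh ^+ m * xh) by rewrite scale1r -exprS exprSr.
have gh : x i3 i1 * xh ^+ m = 1 *: (x i3 i1 * xh ^+ m) by rewrite scale1r.
rewrite !mulrDr !mulrDl -!scalerAr -!scalerAl.
rewrite (monomial_insert _ ca da kh) (monomial_insert _ cb db kh).
rewrite (monomial_insert _ ca da hh) (monomial_insert _ cb db gh).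
rewrite (monomial_insert _ cc dc hh) (monomial_insert _ cc dc gh).
rewrite -!scalerAl !scalerA !linearD !linearZ /= -!exprS -!exprSr.
rewrite /haar_word /row_monomial !expr0 !mul1r !mulr1 !expr1 -!exprVn.
rewrite (mulnC 3) (mulnC 2) !exprM.
move: (haar _) (haar _) (haar _) (haar _) (haar _) (haar _) => *.
by ring.
Qed.


Lemma qbinomS1 n : C n.+1 1 = (1 - p ^+ n.+1) / (1 - p).
Proof. by rewrite qbinomSS // qbinom0 // mul1r. Qed.

Local Notation H m := (word m 0 0 m 0 m 0 m 0 0).

(** By [haar_wordE], the left side of [haar_word_qdet] is a multiple of [H m] and the six words on
    its right are multiples of [H m.+1]. *)
Lemma haar_diag_rec m :
  H m.+1 * ((1 - p ^+ m.+2) * (1 - p ^+ m.+3)) =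
  - q ^+ 3 * (1 - p ^+ m.+1) ^+ 2 * H m.
Proof.
have := haar_word_qdet m.
pose E := haar_wordE q_neq0 q_nroot haarP.
rewrite (E m 0 0 m m 0 0 0 m 0)%N ?add0n ?addn0 ?addn1 ?add1n //.
rewrite (E m.+1 1 0 m m 1 0 0 m 1)%N ?add0n ?addn0 ?addn1 ?add1n //.
rewrite (E m.+1 0 1 m m.+1 0 0 0 m 1)%N ?add0n ?addn0 ?addn1 ?add1n //.
rewrite (E m.+1 1 0 m m 0 1 0 m.+1 0)%N ?add0n ?addn0 ?addn1 ?add1n //.
rewrite (E m.+1 0 1 m m 0 1 1 m 0)%N ?add0n ?addn0 ?addn1 ?add1n //.
rewrite (E m.+1 0 0 m.+1 m.+1 0 0 0 m.+1 0)%N ?add0n ?addn0 ?addn1 ?add1n //.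
rewrite (E m.+1 0 0 m.+1 m 1 0 1 m 0)%N ?add0n ?addn0 ?addn1 ?add1n //.
rewrite !(haar_ratioE q_nroot) !qsum0 //.
(* Only two of the seven words contain e. In this one l = 0 leaves the term j = 0; the other has s =
   t = 0. *)
have -> : qsum q 1 m 0 1 1 = 1.
  rewrite /qsum big_nat_recr //= big_nat1 (@qbinom_gt _ _ 0 1) //.
  by rewrite !(mulr0, mul0r) addr0 !qbinom0 // !qbinomnn // divr1 !mulr1.
rewrite qsum_st0 // qbinomnn // qbinomS1 !qpochS !qpoch0.
have ez (e : int) (a b : nat) : e = a%:Z - b%:Z -> q ^ e = q ^+ a / q ^+ b.
  by move=> ->; rewrite expfzDr // exprnN.
have intE := (PoszM, intS m).
do 6!first [ rewrite (@ez _ 0%N m); last by rewrite ?intE; ring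
  | rewrite (@ez _ (2 * m) 3)%N; last by rewrite ?intE; ring
  | rewrite (@ez _ m 2)%N; last by rewrite ?intE; ring
  | rewrite (@ez _ (2 * m) 1)%N; last by rewrite ?intE; ring
  | rewrite (@ez _ 0 m.+1)%N; last by rewrite ?intE; ring
  | rewrite (@ez _ m 0)%N; last by rewrite ?intE; ring ].
rewrite !addn0 !addn1 !(mulnC _ m) !exprM.
have p2 k : p ^+ k = q ^+ k * q ^+ k by rewrite -exprM mulnC exprM expr2.
have g0 : 1 - q * q ^+ m * (q * q ^+ m) != 0.
  by rewrite -exprS -p2 q_nroot.
have b0 : 1 - q * q != 0 by have := q_nroot (ltn0Sn 0); rewrite expr1.
have := qpoch_neq0 q_nroot m; move: (m`_q!) => M M0.
rewrite !p2 !exprS !expr0 !mulr1.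
have s0 : (-1) ^+ m != 0 :> K by rewrite signr_eq0.
have Q0 : q ^+ m != 0 by rewrite expf_neq0.
move: (H m.+1) (H m) ((-1) ^+ m) s0 (q ^+ m) Q0 g0 => h1 h0 S s0 Q Q0 g0 eh.
(* Exhibits the left side of [eh] inside [h0], so that it can be replaced by the six words. *)
have -> : h0 = (S * (1 / Q) * (1 * M * M) / (M * M) * h0) * Q / S.
  by field; rewrite s0 Q0 M0.
rewrite eh; field.
by rewrite s0 Q0 M0 q_neq0 g0 b0 oner_neq0.
Qed.

Lemma haar_diag0 : H 0 = 1.
Proof. by rewrite /haar_word /row_monomial !expr0 !mulr1 haarP.1. Qed.

Lemma haar_diagE m : H m =
  (- q) ^+ (3 * m) * (q ^+ 2 - 1) ^+ 2 * (q ^+ 4 - 1) /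
    ((q ^+ (2 * m + 2) - 1) ^+ 2 * (q ^+ (2 * m + 4) - 1)).
Proof.
have nz k : (0 < k)%N -> p ^+ k - 1 != 0.
  by move=> k0; rewrite -opprB oppr_eq0 q_nroot.
have e2 k : q ^+ (2 * k + 2) = p ^+ k.+1.
  by rewrite -exprM; congr (_ ^+ _); lia.
have e4 k : q ^+ (2 * k + 4) = p ^+ k.+2.
  by rewrite -exprM; congr (_ ^+ _); lia.
have e1 : q ^+ 4 = p ^+ 2 by rewrite -exprM.
elim: m => [|m IHm].
  rewrite haar_diag0 muln0 !add0n expr0 mul1r divff //.
  by rewrite e1 mulf_neq0 ?expf_neq0 ?nz // -[p]expr1 nz.
have nz' k : (0 < k)%N -> 1 - p ^+ k != 0 by apply: q_nroot.
have d0 : (1 - p ^+ m.+2) * (1 - p ^+ m.+3) != 0 by rewrite mulf_neq0 ?nz'.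
apply: (mulIf d0); rewrite haar_diag_rec IHm !e2 !e4 mulnS exprD.
move: (nz m.+1 isT) (nz m.+2 isT) (nz m.+3 isT); rewrite {d0}.
move: ((- q) ^+ (3 * m)) (p ^+ m.+1) (p ^+ m.+2) (p ^+ m.+3).
move=> Z A B D A0 B0 D0.
by field; rewrite A0 B0 D0.
Qed.

End Normalisation.

(** * Real parameters and the theorem *)

(** As q is real, q^2 is nonnegative, and a positive power of it is 1 only if q^2 = 1. *)
Lemma sqr_not_root_of_unity (R : realType) (q : R) :
  q != 1 -> q != -1 ->
  forall n, (0 < n)%N -> 1 - (q%:C ^+ 2) ^+ n != 0.
Proof.
move=> q1 qN1 n n_gt0; rewrite -!rmorphXn -(rmorph1 (real_complex R)) -rmorphB.
rewrite fmorph_eq0 subr_eq0 eq_sym Num.Theory.pexprn_eq1 ?Num.Theory.sqr_ge0 //.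
by rewrite negb_or -lt0n n_gt0 sqrf_eq1 negb_or q1 qN1.
Qed.

Theorem theorem4p1 (R : realType) (q : R)
    (hq0 : q != 0) (hq1 : q != 1) (hqN1 : q != -1)
    (haar : {scalar OGLq (q%:C)}) (haarP : is_haar_state haar)
    (m s r l t : nat)
    (hsr : (s + r <= m)%N) (hsl : (s + l <= m)%N)
    (hrt : (r + t <= m)%N) (hlt : (l + t <= m)%N)
    (hm : (m <= s + r + l + t)%N) :
  let Q : R[i] := q%:C in
  let n := (s + r + l + t - m)%N in
  haar (xc Q ^+ m * xe Q ^+ m * xg Q ^+ m * detinv Q ^+ m) =
    (- Q) ^+ (3 * m) * (Q ^+ 2 - 1) ^+ 2 * (Q ^+ 4 - 1) /
    ((Q ^+ (2 * m + 2) - 1) ^+ 2 * (Q ^+ (2 * m + 4) - 1))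
  /\
  haar (xa Q ^+ s * xb Q ^+ (m - s - r) * xc Q ^+ r *
        xd Q ^+ (m - s - l) * xe Q ^+ n * xf Q ^+ (m - r - t) *
        xg Q ^+ l * xh Q ^+ (m - l - t) * xk Q ^+ t * detinv Q ^+ m) =
    (\sum_(0 <= j < n.+1)
       (-1) ^+ j *
       Q ^ ((n%:Z - j%:Z) * (n%:Z - 3 * j%:Z - 1)
            + 2 * j%:Z * (s%:Z + t%:Z)) *
       (qbinom (Q ^+ 2) r j * qbinom (Q ^+ 2) l j *
        qbinom (Q ^+ 2) s (n - j) * qbinom (Q ^+ 2) t (n - j) /
        qbinom (Q ^+ 2) n j)) *
    ((-1) ^+ (r + l + n) *
     Q ^ ((2 * m%:Z + 1) * (l%:Z + r%:Z) + (n%:Z - 2) * m%:Z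
          - 2 * l%:Z ^+ 2 - 2 * r%:Z ^+ 2 - r%:Z * l%:Z
          + 4 * s%:Z * t%:Z - 3 * n%:Z * s%:Z - 3 * n%:Z * t%:Z) /
     (qmultinom (Q ^+ 2) m n (m - l - s) (m - r - t) *
      qmultinom (Q ^+ 2) m n (m - r - s) (m - l - t))) *
    haar (xc Q ^+ m * xe Q ^+ m * xg Q ^+ m * detinv Q ^+ m).
Proof.
move=> Q n.
have Q0 : Q != 0 by rewrite fmorph_eq0.
have Qn := sqr_not_root_of_unity hq1 hqN1.
have HE : haar (xc Q ^+ m * xe Q ^+ m * xg Q ^+ m * detinv Q ^+ m) =
    haar_word haar m 0 0 m 0 m 0 m 0 0.
  by rewrite /haar_word /row_monomial !expr0 !(mul1r, mulr1).
rewrite HE; split; first exact: haar_diagE.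
rewrite (subnAC m l s) (subnAC m r s).
transitivity (haar_word haar m s (m - s - r) r (m - s - l) n (m - r - t)
  l (m - l - t) t).
  by rewrite /haar_word /row_monomial !mulrA.
(* The hypotheses make the truncated subtractions exact, so all row and column sums are m. *)
by apply: haar_wordE => //; rewrite /n; lia.
Qed.
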